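(* Let $(V,Q,\mathcal{Z},\mathbf{G})$ be an alternative Voronoi space and let $Z\in\mathcal{Z}$. (i) $Z$ is strictly extreme if and only if $(Q,Z_{\min})$ is perfect and eutactic. (ii) $Z$ is extreme if and only if there exists a nonempty subset $X\subseteq Z_{\min}$ such that $(Q,X)$ is weakly perfect and eutactic.
   Context: An alternative Voronoi space $(V,Q,\mathcal{Z},\mathbf{G})$ consists of a finite-dimensional real vector space $V$, a positive definite quadratic form $Q$ on $V$ (bilinear form also denoted $Q$, $Q(x)=Q(x,x)$), a set $\mathcal{Z}$ (closed for the topology of simple convergence) of closed discrete subsets $Z\subseteq V$ with $0\notin Z$ spanning $V$, and a closed linear Lie group $\mathbf{G}<\mathrm{GL}(V)$ such that: (i) if $Z\in\mathcal{Z}$, $c>0$ and $cZ\in\mathcal{Z}$ then $c=1$; (ii) for all $g\in\mathbf{G}$, the $Q$-adjoint $g^*_Q$ (defined by $Q(x,gy)=Q(g^*_Qx,y)$) lies in $\mathbf{G}$ and $g^*_Qg\in\mathbf{G}^0$; (iii) $gZ\in\mathcal{Z}$ for $g\in\mathbf{G}$, $Z\in\mathcal{Z}$, and $\mathbf{G}$ is transitive on $\mathcal{Z}$. Let $\mathfrak{g}$ be the Lie algebra of $\mathbf{G}$, $\mathfrak{p}=\{H\in\mathfrak{g}: H^*_Q=H\}$, $\mathbf{K}=\{g\in\mathbf{G}: g^*_Q=g^{-1}\}$. The Hermite function on $\mathbf{K}\backslash\mathcal{Z}$ is $\gamma(\mathbf{K}Z)=\min_{x\in Z}Q(x)$, and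 $Z_{\min}=\{x\in Z: Q(x)=\gamma(\mathbf{K}Z)\}$. $Z$ is extreme (resp. strictly extreme) if $\mathbf{K}Z$ is a local (resp. strict local) maximum of $\gamma$ on $\mathbf{K}\backslash\mathcal{Z}$, where a neighborhood basis of $\mathbf{K}Z$ is $\{\mathbf{K}\exp(H/2)Z: H\in\mathfrak{p},\ \|H\|_Q<\epsilon\}$, $\epsilon>0$, with $\|H\|_Q^2=\sup_{x\ne0}Q(Hx)/Q(x)$. For nonempty finite $X\subseteq V\setminus\{0\}$: $(Q,X)$ is eutactic if for every $H\in\mathfrak{g}$, the existence of $x\in X$ with $Q(x,Hx)>0$ implies the existence of $y\in X$ with $Q(y,Hy)<0$; weakly perfect if for every $H\in\mathfrak{g}$ and $c\in\mathbb{R}$ with $Q(x,Hx)=cQ(x)$ for all $x\in X$, we have $Hx+H^*_Qx=2cx$ for all $x\in X$; perfect if under the same hypothesis $H+H^*_Q=2c\,\mathrm{id}_V$. *)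

(* Defs.v *)
From HB Require Import structures.
From mathcomp Require Import all_boot all_order all_algebra.
From mathcomp Require Import all_classical all_reals all_analysis.
Set Implicit Arguments.
Unset Strict Implicit.
Unset Printing Implicit Defensive.
Import Order.TTheory GRing.Theory Num.Theory.
Import numFieldNormedType.Exports.
Local Open Scope classical_set_scope.
Local Open Scope ring_scope.

(* The canonical topology of a finite-dimensional real vector space, pulled
   back from R^n along a linear coordinate isomorphism. It is used both for V
   and for 'End(V). *)
Definition fdtop (R : realType) (W : vectType R) : topologicalType :=
  initial_topology (passmx.rVof (vbasis {:W})).

Section Endomorphisms.
Context {R : realType} {V : vectType R}.
Implicit Types (Q : {dot V for idfun}) (g H : 'End(V)) (G : set 'End(V)).

(* The Q-adjoint; [adjP] below shows that it exists. *)
Definition adj Q g : 'End(V) :=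
  xget 0 [set h : 'End(V) | forall x y, Q x (g y) = Q (h x) y].

Definition lfun_iter H (k : nat) : 'End(V) := iter k (comp_lfun H) \1%VF.

Definition lfun_exp H : 'End(V) :=
  xget 0 [set E : 'End(V) | (fun n => \sum_(k < n) k`!%:R^-1 *: lfun_iter H k
                    : fdtop 'End(V)) @ \oo --> (E : fdtop 'End(V))].

Definition GL : set 'End(V) := [set g | lker g == 0%VS].

Definition closed_linear_group G :=
  [/\ G `<=` GL,
      G \1%VF,
      (forall g h, G g -> G h -> G (g \o h)%VF),
      (forall g, G g -> G (g^-1)%VF)
    & closure (G : set (fdtop 'End(V))) `&` GL `<=` G].

Definition identity_component G : set 'End(V) :=
  connected_component (G : set (fdtop 'End(V))) \1%VF.

Definition lie_algebra G : set 'End(V) :=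
  [set H | forall t : R, G (lfun_exp (t *: H))].

Definition lie_sym Q G : set 'End(V) := [set H | lie_algebra G H /\ adj Q H = H].

Definition isometries Q G : set 'End(V) := [set g | G g /\ adj Q g = (g^-1)%VF].

Definition opnorm Q H : R :=
  Num.sqrt (sup [set Q (H x) (H x) / Q x x | x in [set x | x != 0]]).

Lemma adjP Q g x y : Q x (g y) = Q (adj Q g x) y.
Proof.
suff [h hP] : exists h : 'End(V), forall x y, Q x (g y) = Q (h x) y.
  by rewrite /adj; case: xgetP => [_ -> /(_ x y)//|/(_ h)].
pose b (j : 'I_(\dim {:V})) : V := (vbasis {:V})`_j.
pose f (k : 'End(V)) (x : V) := \row_j Q x (k (b j)).
have f_lin k : linear (f k).
  move=> a u v; apply/rowP => j; rewrite !mxE.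
  by rewrite linearPl.
pose F k := linfun (HB.pack (f k)
  (GRing.isLinear.Build _ _ _ _ (f k) (f_lin k)) : {linear V -> 'rV[R]_(\dim {:V})}).
have FE k u : F k u = f k u by rewrite lfunE.
have bspan (v : V) : v = \sum_j coord (vbasis {:V}) j v *: b j.
  exact: coord_vbasis (memvf _).
have ext (u : V) (v : V) (k l : 'End(V)) :
  f k u = f l v -> forall y, Q u (k y) = Q v (l y).
  move=> e y'; rewrite (bspan y') !linear_sum /=.
  apply: eq_bigr => j _; rewrite !linearZ /=; congr (_ * _).
  by move/rowP/(_ j): e; rewrite !mxE.
have f0 : f \1%VF 0 = 0 by apply/rowP => j; rewrite !mxE linear0l.
have inj : lker (F \1%VF) == 0%VS.
  apply/eqP/vspaceP => u; rewrite memv_ker memv0 FE.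
  apply/eqP/eqP => [e|-> //]; apply/eqP/negPn/negP => /(neq0_dnorm_gt0 (s := Q)).
  have /(_ u) := @ext u 0 \1%VF \1%VF (etrans e (esym f0)).
  by rewrite !lfunE /= linear0l => ->; rewrite ltxx.
have surj w : exists u, F \1%VF u = w.
  have : w \in limg (F \1%VF).
    suff -> : limg (F \1%VF) = fullv by rewrite memvf.
    apply/eqP; rewrite eqEdim subvf /= limg_dim_eq; last first.
      by rewrite (eqP inj) capv0.
    by rewrite !dimvf /dim /= mul1n.
  by move/memv_imgP => [u _ ->]; exists u.
exists ((F \1%VF)^-1 \o F g)%VF => u v; rewrite lfunE /=.
set w := _ (F g u).
have : F \1%VF w = F g u.
  by have [w' e] := surj (F g u); rewrite /w -e lker0_lfunK.
by rewrite !FE => /ext/(_ v); rewrite lfunE.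
Qed.

End Endomorphisms.

Section VoronoiSpaces.
Context {R : realType} {V : vectType R}.
Implicit Types (Q : {dot V for idfun}) (G : set 'End(V)).
Implicit Types (ZZ : set (set V)) (Z X : set V).

Definition admissible Z :=
  [/\ closed (Z : set (fdtop V)),
      Z `<=` isolated (Z : set (fdtop V)),
      ~ Z 0
    & forall v, exists2 s : seq V, (forall x, x \in s -> Z x) & v \in span s].

Definition indicator Z : {ptws V -> bool} := fun x => `[< Z x >].

(* A subset of V is identified with its indicator function. Closedness is
   relative to the admissible subsets: in the space of all subsets of V the
   closure of an orbit ZZ also contains non-spanning sets as soon as the
   identity component of the group is nontrivial. *)
Definition simply_closed ZZ :=
  forall Z, admissible Z ->
    closure [set indicator Y | Y in ZZ] (indicator Z) -> ZZ Z.

Record alternative_voronoi_space Q ZZ G : Prop := AlternativeVoronoiSpace {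
  avs_admissible : ZZ `<=` admissible ;
  avs_closed : simply_closed ZZ ;
  avs_group : closed_linear_group G ;
  avs_scale : forall Z (c : R), ZZ Z -> 0 < c -> ZZ [set c *: x | x in Z] ->
    c = 1 ;
  avs_adj : forall g, G g -> G (adj Q g) ;
  avs_adjM : forall g, G g -> identity_component G (adj Q g \o g)%VF ;
  avs_act : forall g Z, G g -> ZZ Z -> ZZ (g @` Z) ;
  avs_trans : forall Z Z', ZZ Z -> ZZ Z' -> exists2 g, G g & g @` Z = Z' }.

Definition Korbit Q G Z : set (set V) := [set k @` Z | k in isometries Q G].

(* The Hermite function, as a function on ZZ; it descends to K\ZZ by
   [hermite_isometry]. On members of ZZ the infimum is a minimum. *)
Definition hermite Q Z : R := inf [set Q x x | x in Z].

Definition minvec Q Z : set V := [set x | Z x /\ Q x x = hermite Q Z].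

Definition Kclass_ball Q G Z (e : R) : set (set (set V)) :=
  [set Korbit Q G (lfun_exp (2^-1 *: H) @` Z)
    | H in [set H | lie_sym Q G H /\ opnorm Q H < e]].

Definition extreme Q G Z :=
  exists2 e : R, 0 < e &
    forall C, Kclass_ball Q G Z e C ->
    forall Y, C Y -> hermite Q Y <= hermite Q Z.

Definition strictly_extreme Q G Z :=
  exists2 e : R, 0 < e &
    forall C, Kclass_ball Q G Z e C -> C <> Korbit Q G Z ->
    forall Y, C Y -> hermite Q Y < hermite Q Z.

Definition eutactic Q G X :=
  forall H, lie_algebra G H ->
  (exists2 x, X x & 0 < Q x (H x)) -> exists2 y, X y & Q y (H y) < 0.

Definition weakly_perfect Q G X :=
  forall H (c : R), lie_algebra G H ->
  (forall x, X x -> Q x (H x) = c * Q x x) ->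
  forall x, X x -> H x + adj Q H x = (2 * c) *: x.

Definition perfect Q G X :=
  forall H (c : R), lie_algebra G H ->
  (forall x, X x -> Q x (H x) = c * Q x x) ->
  H + adj Q H = (2 * c) *: \1%VF.

Lemma hermite_isometry Q G k Z : G `<=` GL -> isometries Q G k ->
  hermite Q (k @` Z) = hermite Q Z.
Proof.
move=> GGL [Gk kV]; congr inf; rewrite image_comp; apply: eq_imagel => x _ /=.
by rewrite adjP kV lker0_lfunK //; exact: GGL.
Qed.

End VoronoiSpaces.

(* Main.v *)
(** Write [f_x H = Q (exp (H/2) x)] for [H] in [p].  The expansion
    [f_x H = Q x + Q(x, H x) + Q(H x)/2 + O(|H| Q(H x))], in which every term
    beyond the first-order one is controlled by [H x], reduces the behaviour
    of the Hermite function near [K Z] to the finite set [Z_min], because [Z]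
    is closed and discrete.

    Sufficiency: on a complement in [p] of the subspace killing [X], eutaxy and
    weak perfection make some [Q(x, H x)] negative, hence by compactness at most
    [- d |H x|], which beats the quadratic terms.

    Necessity in (i): a direction [D] with [Q(x, D x) >= 0] on [Z_min] does not
    decrease the Hermite function, so [exp (t D / 2) Z] lies in [K Z] for small
    [t], and discreteness of the values of [Q] on [Z] gives [D = 0].

    Necessity in (ii): consider the subsets [S] of [Z_min] for which arbitrarily
    small [H] kill [S] and raise [Q] strictly on the rest of [Z_min].  If [S] is
    not weakly perfect and eutactic, a much smaller multiple of an ascent
    direction [D] added to [H] shows that [{x in S | D x = 0}], which is
    strictly smaller, is again such a subset; extremality forbids reaching the
    empty set.

    That the Lie algebra is a vector space, needed to pass from [H] to
    [H + H^*] and to add directions, is Trotter's product formula. *)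
Require Import Defs.
From HB Require Import structures.
From mathcomp Require Import all_boot all_order all_algebra.
From mathcomp Require Import all_classical all_reals all_analysis.
From mathcomp Require Import ring lra.
Import passmx Order.TTheory GRing.Theory Num.Def Num.Theory.
Import numFieldNormedType.Exports.
Set Implicit Arguments.
Unset Strict Implicit.
Unset Printing Implicit Defensive.
Local Open Scope classical_set_scope.
Local Open Scope ring_scope.

(** * Sublinear functions on finite-dimensional spaces *)

Section Sublinear.
Context {R : realType}.

(** Homogeneity is asked for nonnegative factors only: besides norms, the notion has to cover
    [|q| - q] for a linear form [q], which is not even. *)
Definition sublinear (W : lmodType R) (h : W -> R) :=
  (forall x y, h (x + y) <= h x + h y) /\
  (forall a x, 0 <= a -> h (a *: x) = a * h x).

(** The sup norm of the coordinates that define [fdtop]; every other norm is compared with it. *)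
Definition cnorm {W : vectType R} (w : W) : R :=
  `|rVof (vbasis {:W}) w|.

Lemma mx_coord_le n (c : 'rV[R]_n) i : `|c 0 i| <= `|c|.
Proof.
rewrite [leRHS]/normr /= mx_normrE.
by apply/bigmax_geP; right; exists (0, i).
Qed.

Lemma sublinear0 (W : lmodType R) (h : W -> R) : sublinear h -> h 0 = 0.
Proof. by move=> [_ hZ]; rewrite -(scale0r (0 : W)) hZ // mul0r. Qed.

Lemma sublinear_sum (W : lmodType R) (h : W -> R) I (r : seq I) (F : I -> W) :
  sublinear h -> h (\sum_(i <- r) F i) <= \sum_(i <- r) h (F i).
Proof.
move=> hS; elim: r => [|a r IH]; first by rewrite !big_nil (sublinear0 hS).
by rewrite !big_cons (le_trans (hS.1 _ _)) // lerD2l.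
Qed.

(** Expansion in the basis; both [b_i] and [- b_i] enter the constant because a negative coordinate
    cannot be pulled out of [h]. *)
Lemma sublinear_bound (W : vectType R) (h : W -> R) : sublinear h ->
  exists2 C, 0 <= C & forall w, h w <= C * cnorm w.
Proof.
move=> hS; pose b := vbasis {:W}.
pose C := \sum_(i < \dim {:W}) (`|h b`_i| + `|h (- b`_i)|).
exists C => [|w]; first by apply: sumr_ge0 => i _; rewrite addr_ge0.
rewrite {1}(coord_vbasis (memvf w)) (le_trans (sublinear_sum _ _ hS)) //.
rewrite /C mulr_suml; apply: ler_sum => i _.
have cle : `|coord b i w| <= cnorm w.
  by have := mx_coord_le (rVof b w) i; rewrite mxE.
apply: (@le_trans _ _ (`|coord b i w| * (`|h b`_i| + `|h (- b`_i)|))); last first.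
  by rewrite mulrC ler_wpM2l // addr_ge0.
have [c0|c0] := leP 0 (coord b i w).
  by rewrite hS.2 // ger0_norm // ler_wpM2l // (le_trans (ler_norm _)) // lerDl.
rewrite -[_ *: _]opprK -scalerN -scaleNr hS.2; last by rewrite oppr_ge0 ltW.
have c0' : 0 <= - coord b i w by rewrite oppr_ge0 ltW.
by rewrite ltr0_norm // ler_wpM2l // (le_trans (ler_norm _)) // lerDr.
Qed.

Lemma rVof_vbasisK (W : vectType R) :
  cancel (rVof (vbasis {:W})) (vecof (vbasis {:W})).
Proof. exact/rVofK/vbasisP. Qed.

Lemma vecof_vbasisK (W : vectType R) :
  cancel (vecof (vbasis {:W})) (rVof (vbasis {:W})).
Proof. exact/vecofK/vbasisP. Qed.

Lemma rVof_vbasis_eq0 (W : vectType R) w :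
  (rVof (vbasis {:W}) w == 0) = (w == 0).
Proof. exact/rVof_eq0/vbasisP. Qed.

(** Subadditivity bounds [h u - h v] by [h (u - v)], so [h] is Lipschitz in coordinates. *)
Lemma sublinear_continuous (W : vectType R) (h : W -> R) : sublinear h ->
  continuous (h \o vecof (vbasis {:W})).
Proof.
move=> hS; have [C C0 hC] := sublinear_bound hS.
set f := vecof _.
have lip u v : h (f u) - h (f v) <= C * `|u - v|.
  rewrite lerBlDr -[X in h X <= _](subrK (f v)) (le_trans (hS.1 _ _)) // lerD2r.
  have -> : f u - f v = f (u - v) by rewrite /f linearB.
  by rewrite (le_trans (hC _)) // /cnorm vecof_vbasisK.
move=> u; apply/(@cvgrPdist_lt _ _ _ (nbhs u) (nbhs_filter u)) => e e0.
have C1 : 0 < C + 1 by rewrite ltr_wpDl.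
have d0 : 0 < e / (C + 1) by rewrite divr_gt0.
near=> v.
have uv : `|u - v| < e / (C + 1).
  have : ball u (e / (C + 1)) v by near: v; exact: nbhsx_ballx.
  by rewrite -ball_normE.
apply: (@le_lt_trans _ _ (C * `|u - v|)).
  by rewrite ler_norml lip lerNl opprB distrC lip.
apply: (@le_lt_trans _ _ ((C + 1) * `|u - v|)); first by rewrite ler_wpM2r // lerDl.
by rewrite mulrC -ltr_pdivlMr.
Unshelve. all: by end_near. Qed.

(** The constant is the minimum of [h] on the compact unit sphere of coordinates. *)
Lemma sublinear_coercive (W : vectType R) (h : W -> R) : sublinear h ->
  (forall w, w != 0 -> 0 < h w) ->
  exists2 d, 0 < d & forall w, d * cnorm w <= h w.
Proof.
move=> hS hpos; pose f := vecof (vbasis {:W}).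
pose A := [set c : 'rV[R]_(\dim {:W}) | `|c| = 1].
have normed (c : 'rV[R]_(\dim {:W})) : c != 0 -> A (`|c|^-1 *: c).
  by move=> c0; rewrite /A /= normrZ normfV normr_id mulVf // normr_eq0.
(* The sphere is empty only when [W] is zero, and then any constant works. *)
have [[a Aa]|A0] := pselect (A !=set0); last first.
  exists 1 => // w; have [->|w0] := eqVneq w 0.
    by rewrite (sublinear0 hS) /cnorm linear0 normr0 mulr0.
  exfalso; apply: A0; exists (`|rVof (vbasis {:W}) w|^-1 *: rVof (vbasis {:W}) w).
  by apply: normed; rewrite rVof_vbasis_eq0.
have cA : compact A.
  apply: bounded_closed_compact.
    by exists 1; split => // M M1 c /= ->; exact: ltW.
  have -> : A = (fun c => `|c|) @^-1` [set 1] by [].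
  apply: closed_comp; last exact: closed_eq.
  by move=> c _; exact: norm_continuous.
have cf := continuous_subspaceT (A := A) (sublinear_continuous hS).
have [c cA' cmin] := EVT_min_rV (ex_intro _ a Aa) cA cf.
have {}cA' : `|c| = 1 by move: cA'; rewrite inE.
have fc0 : f c != 0.
  apply/negP => /eqP fc; have := vecof_vbasisK (W := W) c; rewrite -/f fc linear0 => c0.
  by move: cA'; rewrite -c0 normr0 => /eqP; rewrite eq_sym oner_eq0.
exists (h (f c)) => [|w]; first exact: hpos.
have [->|w0] := eqVneq w 0.
  by rewrite (sublinear0 hS) /cnorm linear0 normr0 mulr0.
set u := rVof (vbasis {:W}) w.
have u0 : u != 0 by rewrite rVof_vbasis_eq0.
have nu0 : 0 < `|u| by rewrite normr_gt0.
have := cmin (`|u|^-1 *: u); rewrite inE => /(_ (normed _ u0)).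
rewrite /= linearZ /= hS.2 ?invr_ge0 // /u rVof_vbasisK -/u.
by rewrite mulrC ler_pdivlMr.
Qed.

End Sublinear.

(** * The norm of a dot product and the operator norm *)

Section DotNorm.
Context {R : realType} {V : vectType R} (Q : {dot V for idfun}).
Implicit Types (x y : V) (H A B : 'End(V)).

Lemma dotC x y : Q x y = Q y x.
Proof. by rewrite hermC expr0 mul1r. Qed.

Lemma dot_ge0 x : 0 <= Q x x.
Proof.
have [->|x0] := eqVneq x 0; first by rewrite linear0l.
exact/ltW/neq0_dnorm_gt0.
Qed.

Lemma dot_eq0 x : Q x x = 0 -> x = 0.
Proof.
move=> e; apply/eqP/negPn/negP => /(neq0_dnorm_gt0 (s := Q)).
by rewrite e ltxx.
Qed.

Lemma dotZl a x y : Q (a *: x) y = a * Q x y.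
Proof. exact: linearZl_LR. Qed.

Lemma dotZr a x y : Q x (a *: y) = a * Q x y.
Proof. exact: linearZr_LR. Qed.

Lemma dotDD a b x y : Q (a *: x + b *: y) (a *: x + b *: y) =
  a ^+ 2 * Q x x + 2 * (a * b) * Q x y + b ^+ 2 * Q y y.
Proof.
rewrite !(linearDl, linearDr) /= !(dotZl, dotZr) (dotC y x); ring.
Qed.

Definition dnrm x : R := Num.sqrt (Q x x).

Lemma dnrm_ge0 x : 0 <= dnrm x. Proof. exact: sqrtr_ge0. Qed.

Lemma dnrm_sqr x : dnrm x ^+ 2 = Q x x.
Proof. by rewrite sqr_sqrtr // dot_ge0. Qed.

Lemma dnrm_gt0 x : x != 0 -> 0 < dnrm x.
Proof. by move=> x0; rewrite sqrtr_gt0; exact: neq0_dnorm_gt0. Qed.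

Lemma dnrm0 : dnrm 0 = 0.
Proof. by rewrite /dnrm linear0l sqrtr0. Qed.

Lemma dot_le x y : `|Q x y| <= dnrm x * dnrm y.
Proof.
rewrite -(@ler_pXn2r _ 2) ?nnegrE ?mulr_ge0 ?dnrm_ge0 //.
rewrite real_normK ?num_real // exprMn !dnrm_sqr.
have [->|y0] := eqVneq y 0; first by rewrite linear0r expr0n /= mulr_ge0 ?dot_ge0.
have q0 : 0 < Q y y by exact: neq0_dnorm_gt0.
have := dot_ge0 (Q y y *: x + (- Q x y) *: y); rewrite dotDD.
rewrite (_ : _ + _ = Q y y * (Q x x * Q y y - Q x y ^+ 2)); last by ring.
by rewrite pmulr_rge0 // subr_ge0.
Qed.

Lemma dnrmD x y : dnrm (x + y) <= dnrm x + dnrm y.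
Proof.
rewrite -(@ler_pXn2r _ 2) ?nnegrE ?addr_ge0 ?dnrm_ge0 //.
have := dotDD 1 1 x y; rewrite !scale1r sqrrD !dnrm_sqr => ->.
have := le_trans (ler_norm _) (dot_le x y); lra.
Qed.

Lemma dnrmZ a x : dnrm (a *: x) = `|a| * dnrm x.
Proof.
by rewrite /dnrm dotZl dotZr mulrA -expr2 sqrtrM ?sqr_ge0 // sqrtr_sqr.
Qed.

Lemma dnrm_sublinear : sublinear dnrm.
Proof. by split=> [|a x a0]; [exact: dnrmD|rewrite dnrmZ ger0_norm]. Qed.

Lemma dnrm_coercive : exists2 d, 0 < d & forall x, d * cnorm x <= dnrm x.
Proof. exact: (sublinear_coercive dnrm_sublinear dnrm_gt0). Qed.

(** Boundedness is what makes the supremum in [opnorm] an upper bound of the ratios, since [sup] of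
    an unbounded set is only a default value. *)
Lemma lfun_bounded H : exists2 a, 0 <= a & forall x, dnrm (H x) <= a * dnrm x.
Proof.
have hS : sublinear (dnrm \o H).
  split=> [x y|a x a0] /=; first by rewrite linearD dnrmD.
  by rewrite linearZ /= dnrmZ ger0_norm.
have [C C0 hC] := sublinear_bound hS; have [d d0 hd] := dnrm_coercive.
exists (C / d) => [|x]; first by rewrite divr_ge0 // ltW.
rewrite (le_trans (hC x)) // -mulrA ler_wpM2l //.
by rewrite mulrC ler_pdivlMr // mulrC.
Qed.

Local Notation opn := (opnorm Q).

Lemma opnorm_ge0 H : 0 <= opn H. Proof. exact: sqrtr_ge0. Qed.

Let ratios H := [set Q (H x) (H x) / Q x x | x in [set x : V | x != 0]].

Lemma opnormP H x : dnrm (H x) <= opn H * dnrm x.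
Proof.
have [->|x0] := eqVneq x 0; first by rewrite linear0 dnrm0 mulr0.
have [a a0 ha] := lfun_bounded H.
have qx0 : 0 < Q x x by exact: neq0_dnorm_gt0.
have ub : ubound (ratios H) (a ^+ 2).
  move=> _ [y /= y0 <-]; rewrite ler_pdivrMr; last exact: neq0_dnorm_gt0.
  rewrite -!dnrm_sqr -exprMn ler_pXn2r ?nnegrE ?mulr_ge0 ?dnrm_ge0 //.
have le_s : Q (H x) (H x) / Q x x <= sup (ratios H).
  by apply: ub_le_sup; [exists (a ^+ 2)|exists x].
have s0 : 0 <= sup (ratios H) by rewrite (le_trans _ le_s) // divr_ge0 ?dot_ge0.
by rewrite /dnrm /opnorm -sqrtrM // ler_wsqrtr // -ler_pdivrMr.
Qed.

Lemma opnorm_le H a : 0 <= a -> (forall x, dnrm (H x) <= a * dnrm x) ->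
  opn H <= a.
Proof.
move=> a0 ha; rewrite /opnorm -(sqr_sqrtr a0).
rewrite -[leRHS]ger0_norm ?exprn_ge0 ?sqrtr_ge0 // -sqrtr_sqr.
rewrite sqr_sqrtr // ler_wsqrtr //.
(* For [V = 0] there are no ratios, and [sup] of the empty set is 0. *)
have [r0|r0] := pselect (ratios H !=set0); last first.
  rewrite (_ : [set _ | _ in _] = set0) ?sup0 ?sqr_ge0 //.
  by apply/seteqP; split=> // y hy; apply: r0; exists y.
apply: ge_sup => // _ [y /= y0 <-]; rewrite ler_pdivrMr; last exact: neq0_dnorm_gt0.
by rewrite -!dnrm_sqr -exprMn ler_pXn2r ?nnegrE ?mulr_ge0 ?dnrm_ge0.
Qed.

Lemma opnormD A B : opn (A + B) <= opn A + opn B.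
Proof.
apply: opnorm_le => [|x]; first by rewrite addr_ge0 ?opnorm_ge0.
by rewrite lfunE /= (le_trans (dnrmD _ _)) // mulrDl lerD ?opnormP.
Qed.

Lemma opnormZ a A : opn (a *: A) = `|a| * opn A.
Proof.
have le b B : opn (b *: B) <= `|b| * opn B.
  apply: opnorm_le => [|x]; first by rewrite mulr_ge0 ?opnorm_ge0.
  by rewrite lfunE /= dnrmZ -mulrA ler_wpM2l ?opnormP.
apply/eqP; rewrite eq_le le /=; have [->|a0] := eqVneq a 0.
  by rewrite normr0 mul0r opnorm_ge0.
have := le a^-1 (a *: A); rewrite scalerA mulVf // scale1r normfV.
by rewrite mulrC ler_pdivlMr ?normr_gt0 // mulrC.
Qed.

Lemma opnorm_sublinear : sublinear (opnorm Q).
Proof. by split=> [|a x a0]; [exact: opnormD|rewrite opnormZ ger0_norm]. Qed.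

Lemma opnorm0 : opn 0 = 0. Proof. exact: sublinear0 opnorm_sublinear. Qed.

Lemma opnormN A : opn (- A) = opn A.
Proof. by rewrite -scaleN1r opnormZ normrN1 mul1r. Qed.

Lemma opnormB A B : opn (A - B) = opn (B - A).
Proof. by rewrite -opnormN opprB. Qed.

Lemma opnorm1 : opn \1%VF <= 1.
Proof. by apply: opnorm_le => // x; rewrite lfunE mul1r. Qed.

Lemma opnorm_comp A B : opn (A \o B)%VF <= opn A * opn B.
Proof.
apply: opnorm_le => [|x]; first by rewrite mulr_ge0 ?opnorm_ge0.
rewrite lfunE /= (le_trans (opnormP _ _)) // -mulrA ler_wpM2l ?opnormP //.
exact: opnorm_ge0.
Qed.

Lemma opnorm_gt0 A : A != 0 -> 0 < opn A.
Proof.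
move=> A0; rewrite lt_neqAle opnorm_ge0 andbT eq_sym.
apply: contra_neq A0 => A0; apply/lfunP => x; rewrite lfunE /=.
apply/eqP/negPn/negP => /dnrm_gt0; apply/negP; rewrite -leNgt.
by rewrite (le_trans (opnormP _ _)) // A0 mul0r.
Qed.

Lemma opnorm_coercive : exists2 d, 0 < d & forall A, d * cnorm A <= opn A.
Proof. exact: (sublinear_coercive opnorm_sublinear opnorm_gt0). Qed.

Lemma opnorm_sum I (r : seq I) (F : I -> 'End(V)) :
  opn (\sum_(i <- r) F i) <= \sum_(i <- r) opn (F i).
Proof. exact: sublinear_sum opnorm_sublinear. Qed.

Lemma adj_unique (g h : 'End(V)) :
  (forall x y, Q x (g y) = Q (h x) y) -> adj Q g = h.
Proof.
move=> gh; apply/lfunP => x; apply/eqP; rewrite -subr_eq0; apply/eqP.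
by apply: dot_eq0; rewrite linearBl /= -adjP -gh subrr.
Qed.

Lemma adjr (g : 'End(V)) x y : Q (g x) y = Q x (adj Q g y).
Proof. by rewrite dotC adjP dotC. Qed.

End DotNorm.

(** * The exponential series *)

HB.instance Definition _ (R : realType) (n : nat) := Complete.on 'rV[R]_n.

(** * The topology [fdtop] in terms of coordinate norms *)

Section FdTop.
Context {R : realType} {W : vectType R}.

Lemma nbhs_fdtop (w : fdtop W) (A : set (fdtop W)) :
  nbhs w A <-> exists2 e : R, 0 < e & forall v : W, cnorm ((w : W) - v) < e -> A v.
Proof.
split=> [|[e e0 eA]].
  rewrite nbhsE => -[_ [[B Bop <-] Bw] BA].
  have /nbhs_ballP[e /= e0 eB] : nbhs (rVof (vbasis {:W}) w) B.
    exact: open_nbhs_nbhs.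
  exists e => // v vw; apply/BA/eB; rewrite -ball_normE /=.
  by rewrite -linearB.
apply: (@filterS _ _ _ (rVof (vbasis {:W}) @^-1` ball (rVof (vbasis {:W}) w) e)).
  move=> v /=; rewrite -ball_normE /= -linearB; exact: eA.
apply: (@initial_continuous _ _ (rVof (vbasis {:W})) w).
exact: nbhsx_ballx.
Qed.

Lemma fdtop_cvgP (u : nat -> fdtop W) (w : fdtop W) :
  u @ \oo --> w <-> cnorm ((w : W) - (u n : W)) @[n --> \oo] --> (0 : R).
Proof.
split=> [uw|uw A /nbhs_fdtop[e e0 eA]].
  apply/cvgrPdist_lt => e e0.
  have : nbhs w [set v : fdtop W | cnorm ((w : W) - v) < e].
    by apply/nbhs_fdtop; exists e.
  move/uw => [N _ hN]; exists N => // n /hN /=.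
  by rewrite sub0r normrN ger0_norm // /cnorm.
have /cvgrPdist_lt/(_ e e0) [N _ hN] := uw; exists N => // n /hN /=.
by rewrite sub0r normrN ger0_norm ?/cnorm //; exact: eA.
Qed.

End FdTop.

Section Exponential.
Context {R : realType} {V : vectType R} (Q : {dot V for idfun}).
Implicit Types (H A B : 'End(V)).
Local Notation opn := (opnorm Q).

Definition exp_partial H (n : nat) : 'End(V) :=
  \sum_(k < n) k`!%:R^-1 *: lfun_iter H k.

Lemma lfun_iterS H k : lfun_iter H k.+1 = (H \o lfun_iter H k)%VF.
Proof. by []. Qed.

Lemma lfun_iterD H i j :
  lfun_iter H (i + j) = (lfun_iter H i \o lfun_iter H j)%VF.
Proof.
elim: i => [|i IH]; first by rewrite comp_lfun1l.
by rewrite addSn !lfun_iterS IH comp_lfunA.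
Qed.

Lemma lfun_iterZ a H k : lfun_iter (a *: H) k = a ^+ k *: lfun_iter H k.
Proof.
elim: k => [|k IH]; first by rewrite scale1r.
by rewrite !lfun_iterS IH -comp_lfunZl -comp_lfunZr scalerA exprS.
Qed.

Lemma opnorm_iter H k : opn (lfun_iter H k) <= opn H ^+ k.
Proof.
elim: k => [|k IH]; first exact: opnorm1.
rewrite lfun_iterS (le_trans (opnorm_comp _ _ _)) // exprS.
by rewrite ler_wpM2l ?opnorm_ge0.
Qed.

Lemma opnorm_exp_term H k :
  opn (k`!%:R^-1 *: lfun_iter H k) <= exp_coeff (opn H) k.
Proof.
rewrite opnormZ ger0_norm ?invr_ge0 // /exp_coeff /= mulrC.
by rewrite ler_wpM2r ?invr_ge0 // opnorm_iter.
Qed.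

(** [lfun_exp] chooses a limit, with default 0, so convergence has to be proved: in coordinates the
    k-th term is at most [|H|^k / k!] divided by [d], and absolutely convergent series of row
    vectors converge. *)
Lemma exp_partial_cvg H :
  opn (exp_partial H n - lfun_exp H) @[n --> \oo] --> (0 : R).
Proof.
have [d d0 hd] := opnorm_coercive Q.
pose r k := rVof (vbasis {:'End(V)}) (k`!%:R^-1 *: lfun_iter H k).
have rE n : rVof (vbasis {:'End(V)}) (exp_partial H n) = series r n.
  by rewrite linear_sum /series /= big_mkord.
have cr : cvgn (series r).
  apply: normed_cvg.
  have cv : cvgn (series (fun k => d^-1 * exp_coeff (opn H) k)).
    apply: is_cvg_seriesZ; exact: is_cvg_series_exp_coeff.
  apply: series_le_cvg cv => k //=.
    by rewrite mulr_ge0 ?invr_ge0 ?(ltW d0) ?exp_coeff_ge0 ?opnorm_ge0.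
  rewrite mulrC ler_pdivlMr // mulrC (le_trans (hd _)) //.
  exact: opnorm_exp_term.
have [l hl] : exists l : 'rV[R]_(\dim {:'End(V)}), series r @ \oo --> l.
  by exists (limn (series r)).
have cn E : cnorm (E - exp_partial H n) @[n --> \oo] --> (0 : R) ->
    opn (exp_partial H n - E) @[n --> \oo] --> (0 : R).
  have [C C0 hC] := sublinear_bound (opnorm_sublinear Q).
  move=> h; apply: (@squeeze_cvgr _ _ _ _ (cst 0)
    (fun n => C * cnorm (E - exp_partial H n))).
  - by apply: nearW => n; rewrite opnorm_ge0 opnormB hC.
  - exact: cvg_cst.
  - by rewrite -(mulr0 C); apply: cvgM => //; exact: cvg_cst.
apply: cn; apply/fdtop_cvgP.
(* The case where no limit exists is refuted by the operator with coordinates [l]. *)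
rewrite /lfun_exp; case: xgetP => [E -> //|].
move=> /(_ (vecof (vbasis {:'End(V)}) l)) []; apply/fdtop_cvgP.
rewrite (_ : (fun n => _) = (fun n => `|l - series r n|)).
  move/cvgrPdist_lt: hl => hl; apply/cvgrPdist_lt => e e0.
  by have [N _ hN] := hl e e0; exists N => // n /hN; rewrite /= sub0r normrN normr_id.
by apply/funext => n; rewrite /cnorm linearB /= vecof_vbasisK -rE.
Qed.

Lemma exp_partial_near H e : 0 < e ->
  exists N, forall n, (N <= n)%N -> opn (exp_partial H n - lfun_exp H) < e.
Proof.
move=> e0; have /cvgrPdist_lt/(_ e e0) [N _ hN] := exp_partial_cvg H.
exists N => n /hN /=; rewrite sub0r normrN ger0_norm //; exact: opnorm_ge0.
Qed.

(** Closed bounds survive the limit, so estimates can be proved on partial sums. *)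
Lemma exp_close A H b :
  (exists N, forall n, (N <= n)%N -> opn (exp_partial H n - A) <= b) ->
  opn (lfun_exp H - A) <= b.
Proof.
move=> [M hb]; apply/ler_addgt0Pr => e e0; have [N hN] := exp_partial_near H e0.
pose n := maxn M N.
rewrite -(subrKA (exp_partial H n)) (le_trans (opnormD _ _ _)) // addrC lerD //.
  by rewrite hb ?leq_maxl.
by rewrite opnormB ltW // hN ?leq_maxr.
Qed.

End Exponential.

Local Arguments lfun_iter {R V} H k : simpl never.

(** * Cauchy products of exponential series *)

Section CauchyProduct.
Context {R : realType}.

Definition exp_coeff2 (s t : R) i j := exp_coeff s i * exp_coeff t j.

Lemma exp_coeffD (s t : R) n :
  exp_coeff (s + t) n = \sum_(0 <= i < n.+1) exp_coeff2 s t i (n - i).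
Proof.
rewrite /exp_coeff2 /exp_coeff /= addrC exprDn mulr_suml big_mkord.
apply: eq_bigr => i _; have le_in : (i <= n)%N by rewrite -ltnS.
have f0 m : (m`!%:R : R) != 0 by rewrite pnatr_eq0 -lt0n fact_gt0.
have := congr1 (fun k : nat => k%:R : R) (bin_fact le_in); rewrite !natrM => e.
rewrite -mulr_natr -e; field; rewrite !f0 /=.
by apply/eqP => b0; move: (f0 n); rewrite -e b0 mul0r eqxx.
Qed.

(** The triangle [i + j < n] is summed along antidiagonals. The family [u] is arbitrary so that both
    scalars and powers of an operator fit. *)
Lemma exp_cauchy (W : lmodType R) (u : nat -> W) s t n :
  \sum_(0 <= k < n) exp_coeff (s + t) k *: u k =
  \sum_(0 <= i < n) \sum_(0 <= j < n - i) exp_coeff2 s t i j *: u (i + j)%N.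
Proof.
elim: n => [|n IH]; first by rewrite !big_nil.
rewrite big_nat_recr //= IH exp_coeffD scaler_suml.
rewrite [RHS](eq_big_nat _ _ (F2 := fun i =>
   \sum_(0 <= j < n - i) exp_coeff2 s t i j *: u (i + j)%N
   + exp_coeff2 s t i (n - i) *: u n)); last first.
  move=> i /andP[_ lt_in]; rewrite subSn // big_nat_recr //=.
  by rewrite subnKC.
rewrite big_split /=; congr (_ + _).
by rewrite [RHS]big_nat_recr //= subnn big_nil addr0.
Qed.

(** The square minus the triangle, the error made when partial sums are multiplied. *)
Lemma exp_cauchy_tail (W : lmodType R) (u : nat -> W) s t n :
  \sum_(0 <= i < n) \sum_(0 <= j < n) exp_coeff2 s t i j *: u (i + j)%N -
  \sum_(0 <= k < n) exp_coeff (s + t) k *: u k =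
  \sum_(0 <= i < n) \sum_(n - i <= j < n) exp_coeff2 s t i j *: u (i + j)%N.
Proof.
rewrite exp_cauchy -sumrB; apply: eq_bigr => i _.
by rewrite (@big_cat_nat _ _ _ (n - i)) ?leq_subr //= addrAC subrr add0r.
Qed.

Lemma series_exp_le (a : R) n : 0 <= a -> series (exp_coeff a) n <= expR a.
Proof.
move=> a0; apply: nondecreasing_cvgn_le; last exact: is_cvg_series_exp_coeff.
by apply: nondecreasing_series => k _ _; exact: exp_coeff_ge0.
Qed.

Lemma series_inv_fact_le n : \sum_(k < n) (k`!%:R^-1 : R) <= expR 1.
Proof.
apply: le_trans (series_exp_le n ler01); rewrite /series /= big_mkord.
by apply: ler_sum => k _; rewrite /exp_coeff /= expr1n mul1r.
Qed.

Lemma inv_fact_anti m n :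
  (m <= n)%N -> (n`!%:R^-1 : R) <= m`!%:R^-1.
Proof.
move=> mn; rewrite lef_pV2 ?posrE ?ltr0n ?fact_gt0 // ler_nat.
by rewrite leq_fact.
Qed.

End CauchyProduct.

(** * Taylor estimates and the one-parameter law for the operator exponential *)

Section ExpBounds.
Context {R : realType} {V : vectType R} (Q : {dot V for idfun}).
Implicit Types (H A B : 'End(V)).
Local Notation opn := (opnorm Q).

Lemma opnorm_small_eq A B : (forall e : R, 0 < e -> opn (A - B) <= e) -> A = B.
Proof.
move=> h; apply/eqP; rewrite -subr_eq0; apply/negPn/negP => /(opnorm_gt0 Q) AB.
have := h (opn (A - B) / 2); lra.
Qed.

Lemma opnorm_exp H : opn (lfun_exp H) <= expR (opn H).
Proof.
rewrite -[lfun_exp H]subr0; apply: exp_close; exists 0%N => n _; rewrite subr0.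
rewrite (le_trans (opnorm_sum _ _ _)) //.
apply: le_trans (series_exp_le n (opnorm_ge0 _ _)); rewrite /series /= big_mkord.
by apply: ler_sum => k _; exact: opnorm_exp_term.
Qed.

Lemma exp_partialD H m n : exp_partial H (m + n) =
  exp_partial H m + \sum_(i < n) (m + i)`!%:R^-1 *: lfun_iter H (m + i).
Proof. by rewrite /exp_partial big_split_ord. Qed.

Lemma exp_partial2 H : exp_partial H 2 = (\1 + H)%VF.
Proof.
rewrite /exp_partial !big_ord_recr big_ord0 /= add0r !invr1 !scale1r.
by rewrite /lfun_iter /= comp_lfun1r.
Qed.

Lemma exp_partial3 H : exp_partial H 3 = \1%VF + H + 2^-1 *: (H \o H)%VF.
Proof.
by rewrite -exp_partial2 /exp_partial big_ord_recr /= /lfun_iter /= comp_lfun1r.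
Qed.

(** For [|H| <= 1] the term of degree [i + 2] is at most [|H|^2 / i!], and the sum of the [1 / i!]
    is at most [expR 1]. *)
Lemma exp_sub1D H : opn H <= 1 ->
  opn (lfun_exp H - (\1 + H)%VF) <= expR 1 * opn H ^+ 2.
Proof.
move=> h1; apply: exp_close; exists 2%N => -[|[|n]] // _.
rewrite -(add2n n) exp_partialD exp_partial2 addrAC subrr add0r.
rewrite (le_trans (opnorm_sum _ _ _)) //.
apply: le_trans (ler_wpM2r (sqr_ge0 _) (series_inv_fact_le n)).
rewrite mulr_suml; apply: ler_sum => i _.
rewrite opnormZ ger0_norm ?invr_ge0 //; apply: ler_pM => //.
- exact: opnorm_ge0.
- by apply: inv_fact_anti; rewrite leq_addl.
- rewrite (le_trans (opnorm_iter _ _ _)) // exprD ler_piMr ?sqr_ge0 //.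
  by rewrite exprn_ile1 ?opnorm_ge0.
Qed.

Lemma dot_opnorm A x y : `|Q x (A y)| <= opn A * (dnrm Q x * dnrm Q y).
Proof.
rewrite (le_trans (dot_le _ _ _)) // mulrCA ler_wpM2l ?dnrm_ge0 //.
exact: opnormP.
Qed.

Lemma dot_exp_close H x y (c b : R) :
  (exists N, forall n, (N <= n)%N -> `|Q x (exp_partial H n y) - c| <= b) ->
  `|Q x (lfun_exp H y) - c| <= b.
Proof.
move=> [M hb]; apply/ler_addgt0Pr => e e0.
pose k := dnrm Q x * dnrm Q y + 1.
have k0 : 0 < k by rewrite ltr_wpDl // mulr_ge0 ?dnrm_ge0.
have [N hN] := exp_partial_near Q H (divr_gt0 e0 k0).
pose n := maxn M N.
rewrite -(subrKA (Q x (exp_partial H n y))) addrC (le_trans (ler_normD _ _)) //.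
rewrite lerD ?hb ?leq_maxl //.
have := dot_opnorm (lfun_exp H - exp_partial H n) x y.
rewrite lfunE /= lfunE /= linearBr /= => /le_trans; apply.
have := hN n (leq_maxr _ _); rewrite opnormB ltr_pdivlMr // => /ltW.
apply: le_trans; rewrite ler_wpM2l ?opnorm_ge0 //.
by rewrite /k lerDl.
Qed.

(** By symmetry the term of degree [i + 3] involves [Q(H x, H^(i+1) H x)], so the remainder is
    controlled by [Q(H x)] and vanishes wherever [H x] does. *)
Lemma exp_sub1D_dot H x : adj Q H = H -> opn H <= 1 ->
  `|Q x (lfun_exp H x) - (Q x x + Q x (H x) + 2^-1 * Q (H x) (H x))| <=
    expR 1 * opn H * Q (H x) (H x).
Proof.
move=> Hsym h1; apply: dot_exp_close; exists 3%N => -[|[|[|n]]] // _.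
rewrite -(add3n n) exp_partialD exp_partial3 add_lfunE linearDr /=.
set r := (X in _ + X - _).
rewrite !add_lfunE scale_lfunE comp_lfunE id_lfunE !linearDr /= dotZr.
rewrite (adjP _ _ x (H x)) Hsym.
rewrite addrAC subrr add0r /r.
rewrite sum_lfunE linear_sumr /= (le_trans (ler_norm_sum _ _ _)) //.
apply: (@le_trans _ _ (\sum_(i < n) i`!%:R^-1 * (opn H * Q (H x) (H x)))); last first.
  rewrite -mulr_suml -mulrA ler_wpM2r ?series_inv_fact_le //.
  by rewrite mulr_ge0 ?opnorm_ge0 ?dot_ge0.
apply: ler_sum => i _; rewrite lfunE /= dotZr normrM ger0_norm ?invr_ge0 //.
apply: ler_pM => //; first by apply: inv_fact_anti; rewrite leq_addl.
rewrite (_ : lfun_iter H (3 + i) = (H \o lfun_iter H i.+1 \o H)%VF); last first.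
  have H1 : lfun_iter H 1 = H by rewrite /lfun_iter /= comp_lfun1r.
  transitivity (lfun_iter H 1 \o lfun_iter H i.+1 \o lfun_iter H 1)%VF.
    by rewrite -!lfun_iterD addn1.
  by rewrite H1.
rewrite 2!comp_lfunE.
rewrite adjP Hsym (le_trans (dot_opnorm _ _ _)) // -expr2 dnrm_sqr.
rewrite ler_wpM2r ?dot_ge0 // (le_trans (opnorm_iter _ _ _)) // exprS.
by rewrite ler_piMr ?opnorm_ge0 // exprn_ile1 ?opnorm_ge0.
Qed.

Lemma lfun_exp_eq H A :
  (forall e : R, 0 < e -> exists N, forall n, (N <= n)%N ->
     opn (exp_partial H n - A) <= e) -> lfun_exp H = A.
Proof. by move=> h; apply: opnorm_small_eq => e /h; exact: exp_close. Qed.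

Lemma lfun_exp0 : lfun_exp 0 = \1%VF :> 'End(V).
Proof.
apply: lfun_exp_eq => e e0; exists 1%N => -[|n] // _.
rewrite -(add1n n) exp_partialD big1 => [|i _]; last first.
  by rewrite add1n lfun_iterS comp_lfun0l scaler0.
rewrite /exp_partial big_ord1 invr1 scale1r addr0 subrr opnorm0.
exact: ltW.
Qed.

(** Induction on [A^(k+1) - B^(k+1) = A (A^k - B^k) + (A - B) B^k]; the hypothesis [1 <= M] allows
    the exponent [k] in place of [k - 1]. *)
Lemma opnorm_iterB A B M k : 1 <= M -> opn A <= M -> opn B <= M ->
  opn (lfun_iter A k - lfun_iter B k) <= k%:R * M ^+ k * opn (A - B).
Proof.
move=> M1 aM bM; have M0 : 0 <= M by rewrite (le_trans ler01).
elim: k => [|k IH]; first by rewrite subrr opnorm0 !mul0r.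
rewrite !lfun_iterS.
have -> : (A \o lfun_iter A k)%VF - (B \o lfun_iter B k)%VF =
   (A \o (lfun_iter A k - lfun_iter B k))%VF + ((A - B) \o lfun_iter B k)%VF.
  by rewrite comp_lfunDr comp_lfunDl comp_lfunNr comp_lfunNl addrA subrK.
rewrite (le_trans (opnormD _ _ _)) // -natr1 !mulrDl mul1r lerD //.
  rewrite (le_trans (opnorm_comp _ _ _)) // exprS mulrCA -mulrA.
  by rewrite ler_pM ?opnorm_ge0.
rewrite (le_trans (opnorm_comp _ _ _)) // mulrC ler_wpM2r ?opnorm_ge0 //.
rewrite (le_trans (opnorm_iter _ _ _)) // (@le_trans _ _ (M ^+ k)) //.
  by rewrite lerXn2r ?nnegrE ?opnorm_ge0.
by rewrite exprS ler_peMl ?exprn_ge0.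
Qed.

(** With [M = 1] the k-th powers differ by at most [k |A - B|], and the sum of [k / k! = 1 / (k-1)!]
    is at most [expR 1]. *)
Lemma opnorm_expB A B : opn A <= 1 -> opn B <= 1 ->
  opn (lfun_exp A - lfun_exp B) <= expR 1 * opn (A - B).
Proof.
move=> a1 b1.
have part n : opn (exp_partial A n - exp_partial B n) <= expR 1 * opn (A - B).
  rewrite /exp_partial -sumrB (le_trans (opnorm_sum _ _ _)) //.
  case: n => [|n]; first by rewrite big_ord0 mulr_ge0 ?expR_ge0 ?opnorm_ge0.
  rewrite big_ord_recl /= subrr opnorm0 add0r.
  apply: le_trans (ler_wpM2r (opnorm_ge0 _ _) (series_inv_fact_le n)).
  rewrite mulr_suml; apply: ler_sum => i _.
  rewrite -scalerBr opnormZ ger0_norm ?invr_ge0 // (_ : bump 0 i = i.+1) //.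
  rewrite (le_trans (ler_wpM2l _ (opnorm_iterB _ (lexx 1) a1 b1))) ?invr_ge0 //.
  rewrite expr1n mulr1.
  have e : i.+1`!%:R^-1 * i.+1%:R = i`!%:R^-1 :> R.
    by rewrite factS natrM invfM mulrAC mulVf ?mul1r // pnatr_eq0.
  by rewrite mulrA e.
apply/ler_addgt0Pr => e e0; have e2 : 0 < e / 2 by rewrite divr_gt0.
have [M hM] := exp_partial_near Q A e2; have [N hN] := exp_partial_near Q B e2.
pose n := maxn M N.
have -> : lfun_exp A - lfun_exp B = (exp_partial A n - exp_partial B n) -
    (exp_partial A n - lfun_exp A) + (exp_partial B n - lfun_exp B).
  by rewrite opprB [X in _ = X + _]addrC !subrKA.
have := hM n (leq_maxl _ _); have := hN n (leq_maxr _ _); have := part n.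
have := opnormD Q (exp_partial A n - exp_partial B n - (exp_partial A n - lfun_exp A))
  (exp_partial B n - lfun_exp B).
have := opnormD Q (exp_partial A n - exp_partial B n) (- (exp_partial A n - lfun_exp A)).
rewrite opnormN; lra.
Qed.

Lemma adj_iter H k : adj Q (lfun_iter H k) = lfun_iter (adj Q H) k.
Proof.
apply: adj_unique; elim: k => [|k IH] x y; first by rewrite !id_lfunE.
rewrite lfun_iterS comp_lfunE adjP IH -addn1 lfun_iterD comp_lfunE.
by rewrite {3}/lfun_iter /= comp_lfun1r.
Qed.

Lemma adj_exp H : adj Q (lfun_exp H) = lfun_exp (adj Q H).
Proof.
apply: adj_unique => x y; apply/eqP; rewrite -subr_eq0 -normr_le0.
apply/ler_addgt0Pr => e e0; rewrite add0r.
apply: dot_exp_close.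
pose k := dnrm Q x * dnrm Q y + 1.
have k0 : 0 < k by rewrite ltr_wpDl // mulr_ge0 ?dnrm_ge0.
have [N hN] := exp_partial_near Q (adj Q H) (divr_gt0 e0 k0).
exists N => n /hN.
have -> : Q x (exp_partial H n y) = Q y (exp_partial (adj Q H) n x).
  rewrite /exp_partial !sum_lfunE !linear_sumr; apply: eq_bigr => i _ /=.
  by rewrite !scale_lfunE !dotZr adjP adj_iter dotC.
have := dot_opnorm (exp_partial (adj Q H) n - lfun_exp (adj Q H)) y x.
rewrite add_lfunE opp_lfunE linearBr /= (dotC Q _ y) => hle hlt.
apply: (le_trans hle); move/ltW: hlt.
rewrite -(ler_pM2r k0) divfK ?gt_eqF //; apply: le_trans.
by rewrite ler_wpM2l ?opnorm_ge0 // mulrC lerDl.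
Qed.

(** The product of two partial sums misses the partial sum for [s + t] by the square minus the
    triangle. In norm this is at most the same expression for the scalar series at [|s| a] and
    [|t| a], which tends to 0 by [expRD]. *)
Lemma exp_comp s t A :
  (lfun_exp (s *: A) \o lfun_exp (t *: A))%VF = lfun_exp ((s + t) *: A).
Proof.
pose a := opn A; pose P r n := exp_partial (r *: A) n.
have a0 : 0 <= a by exact: opnorm_ge0.
have PE r n : P r n = \sum_(0 <= k < n) exp_coeff r k *: lfun_iter A k.
  rewrite /P /exp_partial big_mkord; apply: eq_bigr => k _.
  by rewrite lfun_iterZ scalerA mulrC.
pose D n := series (exp_coeff (`|s| * a)) n * series (exp_coeff (`|t| * a)) n -
  series (exp_coeff (`|s| * a + `|t| * a)) n.
have tail n : opn ((P s n \o P t n)%VF - P (s + t) n) <= D n.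
  have -> : D n = \sum_(0 <= i < n) \sum_(n - i <= j < n)
      exp_coeff2 (`|s| * a) (`|t| * a) i j *: (1 : R^o).
    rewrite -(exp_cauchy_tail (fun=> 1 : R^o)) /D /series /=; congr (_ - _).
      rewrite mulr_suml; apply: eq_bigr => i _; rewrite mulr_sumr.
      by apply: eq_bigr => j _; rewrite /exp_coeff2 /GRing.scale /= mulr1.
    by apply: eq_bigr => k _; rewrite /GRing.scale /= mulr1.
  have -> : (P s n \o P t n)%VF - P (s + t) n = \sum_(0 <= i < n)
      \sum_(n - i <= j < n) exp_coeff2 s t i j *: lfun_iter A (i + j).
    rewrite -exp_cauchy_tail !PE; congr (_ - _).
    apply/lfunP => x; rewrite comp_lfunE !sum_lfunE; apply: eq_bigr => i _.
    rewrite scale_lfunE linear_sum scaler_sumr sum_lfunE; apply: eq_bigr => j _.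
    by rewrite !scale_lfunE linearZ /= scalerA lfun_iterD comp_lfunE.
  rewrite (le_trans (opnorm_sum _ _ _)) //; apply: ler_sum => i _.
  rewrite (le_trans (opnorm_sum _ _ _)) //; apply: ler_sum => j _.
  rewrite opnormZ /GRing.scale /= mulr1 /exp_coeff2 /exp_coeff /= !normrM !normfV.
  rewrite !normrX !normr_nat !exprMn.
  apply: (@le_trans _ _ (`|s| ^+ i / i`!%:R * (`|t| ^+ j / j`!%:R) * a ^+ (i + j))).
    by rewrite ler_wpM2l ?opnorm_iter // !mulr_ge0 ?invr_ge0 ?exprn_ge0.
  by rewrite exprD le_eqVlt; apply/orP; left; apply/eqP; ring.
have D0 : D n @[n --> \oo] --> (0 : R).
  rewrite -(subrr (expR (`|s| * a + `|t| * a))) {1}expRD.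
  by apply: cvgB; [apply: cvgM|]; exact: is_cvg_series_exp_coeff.
apply/esym; apply: lfun_exp_eq => e e0.
have e3 : 0 < e / 3 by rewrite divr_gt0.
(* [k1] and [k2] will bound the norms of [p] and [v], which multiply the errors [q - v] and [p - u];
   each of three errors then costs [e / 3]. *)
pose k1 := expR (opn (s *: A)); pose k2 := expR (opn (t *: A)).
have k10 : 0 < k1 by exact: expR_gt0.
have k20 : 0 < k2 by exact: expR_gt0.
have [N1 h1] := exp_partial_near Q (s *: A) (divr_gt0 e3 k20).
have [N2 h2] := exp_partial_near Q (t *: A) (divr_gt0 e3 k10).
have /cvgrPdist_lt/(_ _ e3)[N3 _ h3] := D0.
exists (N1 + N2 + N3)%N => n nN.
have n1 : (N1 <= n)%N by rewrite (leq_trans _ nN) // -addnA leq_addr.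
have n2 : (N2 <= n)%N by rewrite (leq_trans _ nN) // addnAC leq_addl.
have n3 : (N3 <= n)%N by rewrite (leq_trans _ nN) // leq_addl.
have {}h1 := h1 n n1; have {}h2 := h2 n n2; have := h3 n n3.
rewrite /= sub0r normrN => {}h3.
have hD : D n < e / 3 by rewrite (le_lt_trans (ler_norm _)).
have := tail n; rewrite /P.
set p := exp_partial (s *: A) n in h1 *; set q := exp_partial (t *: A) n in h2 *.
set u := lfun_exp (s *: A) in h1 *; set v := lfun_exp (t *: A) in h2 *.
have -> : exp_partial ((s + t) *: A) n - (u \o v)%VF =
  - ((p \o q)%VF - exp_partial ((s + t) *: A) n) + ((p \o (q - v))%VF + ((p - u) \o v)%VF).
  rewrite comp_lfunDr comp_lfunDl comp_lfunNr comp_lfunNl opprB.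
  by rewrite subrKA subrKA.
move=> hp; apply: (le_trans (opnormD _ _ _)); rewrite opnormN.
have np : opn p <= k1.
  rewrite (le_trans (opnorm_sum _ _ _)) //.
  apply: le_trans (series_exp_le n (opnorm_ge0 _ _)); rewrite /series /= big_mkord.
  by apply: ler_sum => k _; exact: opnorm_exp_term.
have nv : opn v <= k2 by exact: opnorm_exp.
have b1 : opn (p \o (q - v))%VF <= e / 3.
  rewrite (le_trans (opnorm_comp _ _ _)) // -(divfK (lt0r_neq0 k10) (e / 3)) mulrC.
  by apply: ler_pM (ltW h2) np; exact: opnorm_ge0.
have b2 : opn ((p - u) \o v)%VF <= e / 3.
  rewrite (le_trans (opnorm_comp _ _ _)) // -(divfK (lt0r_neq0 k20) (e / 3)).
  by apply: ler_pM (ltW h1) nv; exact: opnorm_ge0.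
have := opnormD Q (p \o (q - v))%VF ((p - u) \o v)%VF; lra.
Qed.

Lemma lfun_exp_GL A : GL (lfun_exp A).
Proof.
rewrite /GL /=; apply/lker0P => x y exy.
have h z : lfun_exp (- A) (lfun_exp A z) = z.
  have := exp_comp (-1) 1 A; rewrite addNr scale0r scaleN1r scale1r lfun_exp0.
  by move/lfunP/(_ z); rewrite comp_lfunE id_lfunE.
by rewrite -(h x) exy h.
Qed.

Lemma lfun_exp_iter A n : lfun_iter (lfun_exp A) n = lfun_exp (n%:R *: A).
Proof.
elim: n => [|n IH]; first by rewrite scale0r lfun_exp0.
rewrite lfun_iterS IH -{1}(scale1r A) exp_comp.
by rewrite -natr1 addrC.
Qed.

End ExpBounds.

(** * The Lie algebra of a closed linear group *)

Section LieAlgebra.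
Context {R : realType} {V : vectType R} (Q : {dot V for idfun}).
Implicit Types (H A B X Y : 'End(V)) (G : set 'End(V)).
Local Notation opn := (opnorm Q).

Lemma dot_inj x y : (forall u, Q u x = Q u y) -> x = y.
Proof.
move=> h; apply/eqP; rewrite -subr_eq0; apply/eqP/(dot_eq0 (Q := Q)).
by rewrite linearBr /= h subrr.
Qed.

(** Both sides agree with [1 + X + Y] up to second order. *)
Lemma exp_compB X Y (r : R) : opn X + opn Y <= r -> r <= 1 ->
  opn ((lfun_exp X \o lfun_exp Y)%VF - lfun_exp (X + Y)) <=
    (expR 1 ^+ 2 + 3 * expR 1 + 1) * r ^+ 2.
Proof.
move=> hr r1; set c := expR 1.
have X0 := opnorm_ge0 Q X; have Y0 := opnorm_ge0 Q Y.
have c0 : 0 < c by exact: expR_gt0.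
have r0 : 0 <= r by rewrite (le_trans _ hr) // addr_ge0.
have Xr : opn X <= r by lra.
have Yr : opn Y <= r by lra.
have sq (Z : 'End(V)) : opn Z <= r -> opn (lfun_exp Z - (\1 + Z)%VF) <= c * r ^+ 2.
  move=> Zr; rewrite (le_trans (exp_sub1D (le_trans Zr r1))) //.
  by rewrite ler_wpM2l ?(ltW c0) // lerXn2r ?nnegrE ?opnorm_ge0.
set eX := lfun_exp X; set eY := lfun_exp Y; set eZ := lfun_exp (X + Y).
(* Five second-order errors; with [c = expR 1] they are at most [c^2], [c], [c], [1] and [c] times
   [r^2], in this order. *)
have -> : (eX \o eY)%VF - eZ = ((eX - (\1 + X)) \o eY)%VF + (eY - (\1 + Y)%VF) +
   ((X \o (eY - (\1 + Y)))%VF + (X \o Y)%VF - (eZ - (\1 + (X + Y))%VF)).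
  apply/lfunP => v; rewrite !(add_lfunE, opp_lfunE, comp_lfunE, id_lfunE).
  rewrite !linearB !linearD /=; apply: dot_inj => u.
  by rewrite !(linearBr, linearDr, linearNr) /=; ring.
have eYc : opn eY <= c.
  by rewrite (le_trans (opnorm_exp _ _)) // ler_expR (le_trans Yr).
have XYr : opn (X + Y) <= r by rewrite (le_trans (opnormD _ _ _)).
have b1 : opn ((eX - (\1 + X)) \o eY)%VF <= c * r ^+ 2 * c.
  by rewrite (le_trans (opnorm_comp _ _ _)) // ler_pM ?opnorm_ge0 ?sq.
have b2 := sq _ Yr; have b3 := sq _ XYr.
have b4 : opn (X \o (eY - (\1 + Y)))%VF <= 1 * (c * r ^+ 2).
  by rewrite (le_trans (opnorm_comp _ _ _)) // ler_pM ?opnorm_ge0 ?sq // (le_trans Xr).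
have b5 : opn (X \o Y)%VF <= r ^+ 2.
  by rewrite (le_trans (opnorm_comp _ _ _)) // expr2 ler_pM ?opnorm_ge0.
have t1 := opnormD Q (((eX - (\1 + X)) \o eY)%VF + (eY - (\1 + Y)%VF))
  ((X \o (eY - (\1 + Y)))%VF + (X \o Y)%VF - (eZ - (\1 + (X + Y))%VF)).
have t2 := opnormD Q ((eX - (\1 + X)) \o eY)%VF (eY - (\1 + Y)%VF).
have t3 := opnormD Q ((X \o (eY - (\1 + Y)))%VF + (X \o Y)%VF)
  (- (eZ - (\1 + (X + Y))%VF)).
have t4 := opnormD Q (X \o (eY - (\1 + Y)))%VF (X \o Y)%VF.
rewrite opnormN in t3.
apply: (le_trans t1); lra.
Qed.

(** [exp (X + Y)] is the N-th power of [exp ((X + Y) / N)], whose distance to the product of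
    exponentials is at most [C (a / N)^2]. Taking N-th powers costs a factor [N exp a], which leaves
    [b / N]. *)
Lemma trotter X Y e : 0 < e -> exists n : nat,
  opn (lfun_iter (lfun_exp (n.+1%:R^-1 *: X) \o lfun_exp (n.+1%:R^-1 *: Y))%VF n.+1
       - lfun_exp (X + Y)) < e.
Proof.
move=> e0; pose a := opn X + opn Y.
have a0 : 0 <= a by rewrite addr_ge0 ?opnorm_ge0.
pose C := expR 1 ^+ 2 + 3 * expR 1 + 1 : R.
have C0 : 0 < C by rewrite /C ltr_wpDl // addr_ge0 ?sqr_ge0 // mulr_ge0 ?expR_ge0.
pose b := expR a * C * a ^+ 2.
have b0 : 0 <= b by rewrite !mulr_ge0 ?expR_ge0 ?(ltW C0).
(* [N > a + b / e] yields both [a / N <= 1], as [exp_compB] requires, and [b / N < e]. *)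
pose n := truncn (a + b / e).
have be0 : 0 <= b / e by rewrite divr_ge0 // ltW.
have hn : a + b / e < n.+1%:R.
  by rewrite /n truncnS_gt // addr_ge0.
exists n; set N : R := n.+1%:R; have N0 : 0 < N by rewrite ltr0n.
have exN : lfun_exp (X + Y) = lfun_iter (lfun_exp (N^-1 *: (X + Y))) n.+1.
  by rewrite (lfun_exp_iter Q) scalerA divff ?scale1r // gt_eqF.
rewrite exN scalerDr.
have nE (Z : 'End(V)) : opn (N^-1 *: Z) = opn Z / N.
  by rewrite opnormZ ger0_norm ?invr_ge0 ?ltW // mulrC.
have r1 : a / N <= 1 by rewrite ler_pdivrMr // mul1r; lra.
have rE : opn (N^-1 *: X) + opn (N^-1 *: Y) = a / N by rewrite !nE -mulrDl.
pose M := expR (a / N).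
have M1 : 1 <= M by rewrite -expR0 ler_expR divr_ge0 // ltW.
have hA : opn (lfun_exp (N^-1 *: X) \o lfun_exp (N^-1 *: Y))%VF <= M.
  rewrite (le_trans (opnorm_comp _ _ _)) // /M -rE expRD.
  by rewrite ler_pM ?opnorm_ge0 ?opnorm_exp.
have hB : opn (lfun_exp (N^-1 *: X + N^-1 *: Y)) <= M.
  by rewrite (le_trans (opnorm_exp _ _)) // ler_expR -rE opnormD.
apply: (le_lt_trans (opnorm_iterB _ M1 hA hB)).
have MN : M ^+ n.+1 = expR a by rewrite /M -expRM_natl mulrC divfK // gt_eqF.
have := exp_compB (le_refl _ : opn (N^-1 *: X) + opn (N^-1 *: Y) <= _).
rewrite rE => /(_ r1) h.
apply: (@le_lt_trans _ _ (n.+1%:R * M ^+ n.+1 * (C * (a / N) ^+ 2))).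
  by rewrite ler_wpM2l // mulr_ge0 ?exprn_ge0 // (le_trans ler01).
rewrite MN -/N (_ : _ * _ = b / N); last by rewrite /b; field; rewrite gt_eqF.
rewrite ltr_pdivrMr // mulrC -ltr_pdivrMr //.
by apply: le_lt_trans hn; rewrite lerDr.
Qed.

Lemma closure_opnorm G E :
  (forall e : R, 0 < e -> exists2 g, G g & opn (g - E) < e) ->
  closure (G : set (fdtop 'End(V))) E.
Proof.
move=> h B /nbhs_fdtop[e e0 eB]; have [d d0 hd] := opnorm_coercive Q.
have [g Gg gE] := h _ (mulr_gt0 d0 e0); exists g; split=> //; apply: eB.
by rewrite -(ltr_pM2l d0) (le_lt_trans (hd _)) // opnormB.
Qed.

Lemma lie_algebraZ G a H : lie_algebra G H -> lie_algebra G (a *: H).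
Proof. by move=> GH t; rewrite scalerA; exact: GH. Qed.

(** Trotter's products lie in [G], so [exp (t (X + Y))] lies in its closure; being invertible, it
    lies in [G], which is closed relative to [GL]. *)
Lemma lie_algebraD G X Y : closed_linear_group G ->
  lie_algebra G X -> lie_algebra G Y -> lie_algebra G (X + Y).
Proof.
move=> [_ G1 GM _ Gcl] GX GY t; rewrite scalerDr; apply: Gcl; split; last first.
  exact: (lfun_exp_GL Q).
apply: closure_opnorm => e e0; have [n hn] := trotter (t *: X) (t *: Y) e0.
have GX' g k : G g -> G (lfun_iter g k).
  by move=> Gg; elim: k => // k IH; rewrite lfun_iterS; exact: GM.
exists (lfun_iter (lfun_exp (n.+1%:R^-1 *: (t *: X)) \o
  lfun_exp (n.+1%:R^-1 *: (t *: Y)))%VF n.+1); last exact: hn.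
by apply/GX'/GM; rewrite scalerA; [exact: GX|exact: GY].
Qed.

Lemma lfun_adjZ a H : adj Q (a *: H) = a *: adj Q H.
Proof. by apply: adj_unique => x y; rewrite !scale_lfunE dotZr dotZl adjP. Qed.

Lemma lfun_adjD A B : adj Q (A + B) = adj Q A + adj Q B.
Proof.
by apply: adj_unique => x y; rewrite !add_lfunE linearDr linearDl /= !adjP.
Qed.

Lemma lfun_adjK H : adj Q (adj Q H) = H.
Proof. by apply: adj_unique => x y; rewrite dotC -adjP dotC. Qed.

Lemma lie_algebra_adj G H : (forall g, G g -> G (adj Q g)) ->
  lie_algebra G H -> lie_algebra G (adj Q H).
Proof. by move=> Gadj GH t; rewrite -lfun_adjZ -adj_exp; exact/Gadj/GH. Qed.

(** The projection of the Lie algebra onto its symmetric part. It preserves every [Q(x, H x)], so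
    conditions on the Lie algebra reduce to [lie_sym]. *)
Definition sym_part H := 2^-1 *: (H + adj Q H).

Lemma sym_part_dot H x : Q x (sym_part H x) = Q x (H x).
Proof.
rewrite scale_lfunE dotZr add_lfunE linearDr /= -adjr (dotC Q _ x); lra.
Qed.

Lemma sym_part_adj H : adj Q (sym_part H) = sym_part H.
Proof. by rewrite lfun_adjZ lfun_adjD lfun_adjK addrC. Qed.

Lemma sym_part_lie G H : closed_linear_group G -> (forall g, G g -> G (adj Q g)) ->
  lie_algebra G H -> lie_sym Q G (sym_part H).
Proof.
move=> cG Gadj GH; split; last exact: sym_part_adj.
apply: lie_algebraZ; apply: lie_algebraD => //.
exact: lie_algebra_adj Gadj GH.
Qed.

Lemma lie_symD G A B : closed_linear_group G ->
  lie_sym Q G A -> lie_sym Q G B -> lie_sym Q G (A + B).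
Proof.
move=> cG [GA sA] [GB sB]; split; first exact: lie_algebraD.
by rewrite lfun_adjD sA sB.
Qed.

Lemma lie_symZ G a A : lie_sym Q G A -> lie_sym Q G (a *: A).
Proof. by move=> [GA sA]; split; [exact: lie_algebraZ|rewrite lfun_adjZ sA]. Qed.

Lemma lie_sym0 G : closed_linear_group G -> lie_sym Q G 0.
Proof.
move=> [_ G1 _ _ _]; split => [t|]; first by rewrite scaler0 (lfun_exp0 Q).
by apply: adj_unique => x y; rewrite !zero_lfunE linear0l linear0r.
Qed.

End LieAlgebra.

(** * From linearly closed sets to subspaces *)

Section Subspace.
Context {R : realType} {W : vectType R}.

(** A subspace inside [A] of maximal dimension exhausts [A], since adjoining a missing vector would
    raise the dimension. It serves to take complements inside [lie_sym]. *)
Lemma subspace_vspace (A : set W) : A 0 -> (forall x y, A x -> A y -> A (x + y)) ->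
  (forall a x, A x -> A (a *: x)) -> exists U : {vspace W}, forall w, w \in U <-> A w.
Proof.
move=> A0 AD AZ.
pose P n := `[< exists2 U : {vspace W}, \dim U = n & forall w, w \in U -> A w >].
have exP : exists n, P n.
  exists 0%N; apply/asboolP; exists 0%VS; first exact: dimv0.
  by move=> w; rewrite memv0 => /eqP ->.
have ubP n : P n -> (n <= \dim {:W})%N.
  by move/asboolP => [U <- _]; exact/dimvS/subvf.
case: (ex_maxnP exP ubP) => n /asboolP[U dU UA] nmax.
exists U => w; split; first exact: UA.
move=> Aw; apply/negPn/negP => wU.
have : P (\dim (U + <[w]>)%VS).
  apply/asboolP; exists (U + <[w]>)%VS => // v /memv_addP[u uU [_ /vlineP[a ->] ->]].
  by apply: AD; [exact: UA|exact: AZ].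
move/nmax; rewrite -dU leqNgt => /negP; apply.
rewrite ltn_neqAle dimvS ?addvSl // andbT.
apply: contra wU => /eqP e.
have /eqP -> : U == (U + <[w]>)%VS by rewrite eqEdim addvSl /= -e.
by rewrite memvE addvSr.
Qed.

End Subspace.

(** * Short vectors of closed discrete sets *)

(** If [A] is infinite, the sets missing only finitely many points of [A] form a proper filter. A
    cluster point in [A] is isolated, yet [A] without it belongs to the filter. *)
Lemma compact_isolated_finite (T : topologicalType) (A : set T) :
  compact A -> A `<=` isolated A -> finite_set A.
Proof.
move=> cA Aiso; apply: contrapT => infA.
pose F : set_system T := [set B | finite_set (A `\` B)].
have FF : ProperFilter F.
  apply: Build_ProperFilter_ex => [B FB|].
    apply: contrapT => /set0P/negP/negPn/eqP B0; apply: infA.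
    by move: FB; rewrite /F /= B0 setD0.
  split=> [|B C FB FC|B C BC]; rewrite /F /=.
  - by rewrite setDT.
  - by rewrite setDIr finite_setU.
  - by apply: sub_finite_set; exact: setDS.
have [|x [Ax clx]] := cA F FF; first by rewrite /F /= setDv.
have [_ [B Bx BA]] := Aiso x Ax.
have FD : F (A `\ x).
  by rewrite /F /= setDD; apply: sub_finite_set (finite_set1 x) => y [].
have [y [[Ay yx] By]] := clx _ _ FD Bx; apply: yx.
by have : (B `&` A) y by []; rewrite BA.
Qed.

Section ShortVectors.
Context {R : realType} {V : vectType R} (Q : {dot V for idfun}).
Implicit Types (Z : set V).

Lemma compact_cnorm_ball (M : R) : compact ([set v : V | cnorm v <= M] : set (fdtop V)).
Proof.
pose B := [set c : 'rV[R]_(\dim {:V}) | `|c| <= M].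
have cB : compact B.
  apply: bounded_closed_compact.
    by exists M; split; rewrite ?num_real // => N MN c /= /le_trans; apply; exact: ltW.
  have -> : B = (fun c => `|c|) @^-1` [set x | x <= M] by [].
  apply: closed_comp; last exact: closed_le.
  by move=> c _; exact: norm_continuous.
rewrite (_ : [set _ | _] = (vecof (vbasis {:V}) : _ -> fdtop V) @` B).
  apply: continuous_compact => //; apply: continuous_subspaceT.
  apply: continuous_comp_initial.
  rewrite (_ : _ \o _ = id); first by move=> ?; exact: cvg_id.
  by apply/funext => c /=; rewrite vecof_vbasisK.
apply/seteqP; split=> [v /= vM|_ /= [c cM <-]].
  by exists (rVof (vbasis {:V}) v) => //; rewrite rVof_vbasisK.
by rewrite /cnorm vecof_vbasisK.
Qed.

(** A closed discrete set meets a coordinate ball in a compact set of isolated points. *)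
Lemma finite_short Z (B : R) : admissible Z ->
  finite_set [set x | Z x /\ Q x x <= B].
Proof.
move=> [Zcl Ziso _ _]; have [d d0 hd] := dnrm_coercive Q.
pose M := Num.sqrt B / d.
pose A := [set v : V | cnorm v <= M] `&` Z.
apply: (@sub_finite_set _ _ A).
  move=> x [Zx xB]; split => //=; rewrite /M ler_pdivlMr // mulrC.
  by rewrite (le_trans (hd x)) // ler_wsqrtr.
apply: (@compact_isolated_finite (fdtop V)).
  exact: (@compact_closedI (fdtop V) _ _ (compact_cnorm_ball (M := M)) Zcl).
move=> x [xM Zx]; have [_ [U Ux UZ]] := Ziso x Zx.
split; first by rewrite inE.
exists U => //; apply/seteqP; split=> y.
  by move=> [Uy [_ Zy]]; rewrite -UZ.
move=> ->; split; last by split.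
by have : [set x] x by []; rewrite -UZ => -[].
Qed.

(** Finitely many vectors have value at most [a + 1]; all others are at distance at least 1 from
    [a]. *)
Lemma isolated_values Z (a : R) : admissible Z ->
  exists2 eta : R, 0 < eta & forall x, Z x -> Q x x = a \/ eta <= `|Q x x - a|.
Proof.
move=> admZ; have /finite_seqP[s sE] := finite_short (a + 1) admZ.
have [e e0 he] : exists2 e : R, 0 < e & forall x, x \in s ->
    Q x x = a \/ e <= `|Q x x - a|.
  elim: s {sE} => [|y s [e e0 he]]; first by exists 1.
  have [ya|ya] := eqVneq (Q y y) a.
    by exists e => // x; rewrite in_cons => /orP[/eqP ->|/he //]; left.
  exists (Num.min e `|Q y y - a|).
    by rewrite lt_min e0 normr_gt0 subr_eq0.
  move=> x; rewrite in_cons => /orP[/eqP ->|/he[]]; [right|by left|right].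
    by rewrite ge_min lexx orbT.
  by rewrite ge_min b.
exists (Num.min e 1) => [|x Zx]; first by rewrite lt_min e0 ltr01.
have [xa|xa] := leP (Q x x) (a + 1).
  have : [set` s] x by rewrite -sE.
  by move=> /= /he[|h]; [left|right; rewrite ge_min h].
right; rewrite ge_min; apply/orP; right.
by rewrite (le_trans _ (ler_norm _)) //; lra.
Qed.

Lemma dot_lbound Z : has_lbound [set Q x x | x in Z].
Proof. by exists 0 => _ [x _ <-]; exact: dot_ge0. Qed.

Lemma hermite_le Z x : Z x -> hermite Q Z <= Q x x.
Proof. by move=> Zx; apply: ge_inf; [exact: dot_lbound|exists x]. Qed.

Lemma hermite_ge Z a : Z !=set0 -> (forall x, Z x -> a <= Q x x) ->
  a <= hermite Q Z.
Proof.
move=> [x Zx] h; apply: lb_le_inf; first by exists (Q x x), x.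
by move=> _ [y Zy <-]; exact: h.
Qed.

(** An infimum that is not attained would lie a fixed gap below all the values. *)
Lemma minvec_nonempty Z : admissible Z -> Z !=set0 -> minvec Q Z !=set0.
Proof.
move=> admZ Z0; have [e e0 he] := isolated_values (hermite Q Z) admZ.
apply: contrapT => nmin.
have : hermite Q Z + e <= hermite Q Z; last by lra.
apply: hermite_ge => // x Zx; have [xm|] := he x Zx.
  by case: nmin; exists x.
have := hermite_le Zx; rewrite -subr_ge0 => h; rewrite ger0_norm //; lra.
Qed.

Lemma finite_minvec Z : admissible Z -> exists s : seq V, minvec Q Z = [set` s].
Proof.
move=> admZ; apply/finite_seqP.
apply: (sub_finite_set _ (finite_short (hermite Q Z) admZ)).
by move=> x [Zx xm]; split => //; rewrite xm.
Qed.

End ShortVectors.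

(** * Deformations *)

Section Deformation.
Context {R : realType} {V : vectType R} (Q : {dot V for idfun}).
Implicit Types (Z X : set V) (H : 'End(V)) (G : set 'End(V)).
Local Notation opn := (opnorm Q).

Definition deform H : 'End(V) := lfun_exp (2^-1 *: H).

(** For [|H|] up to this radius, [expR 1 * |H| <= 1/4], so the coefficient [1/2] of [Q(H x)] in the
    expansion is perturbed to a value between [1/4] and [3/4]. *)
Definition small_radius : R := (4 * expR 1)^-1.

Lemma small_radius_gt0 : 0 < small_radius.
Proof. by rewrite invr_gt0 mulr_gt0 ?expR_gt0. Qed.

(** [exp (H/2)] is symmetric and its square is [exp H]. *)
Lemma deform_dot H x : adj Q H = H ->
  Q (deform H x) (deform H x) = Q x (lfun_exp H x).
Proof.
move=> Hs; rewrite adjr adj_exp lfun_adjZ Hs -comp_lfunE (exp_comp Q).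
by rewrite (_ : 2^-1 + 2^-1 = 1 :> R) ?scale1r //; lra.
Qed.

Lemma small_radius_le1 H : opn H <= small_radius -> opn H <= 1.
Proof.
move=> /le_trans; apply; rewrite invf_le1 ?mulr_gt0 ?expR_gt0 //.
have := expR_ge1Dx (1 : R); lra.
Qed.

Lemma deform_bounds H x : adj Q H = H -> opn H <= small_radius ->
  Q x x + Q x (H x) + 4^-1 * Q (H x) (H x) <= Q (deform H x) (deform H x)
  <= Q x x + Q x (H x) + Q (H x) (H x).
Proof.
move=> Hs hr; rewrite deform_dot //.
have := exp_sub1D_dot x Hs (small_radius_le1 hr).
have q0 := dot_ge0 Q (H x).
have : expR 1 * opn H * Q (H x) (H x) <= 4^-1 * Q (H x) (H x).
  rewrite ler_wpM2r // (le_trans (ler_wpM2l (expR_ge0 _) hr)) //.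
  by rewrite /small_radius invfM mulrCA divff ?gt_eqF ?expR_gt0 // mulr1.
rewrite ler_norml => h /andP[h1 h2]; apply/andP; split; lra.
Qed.

Lemma deform_dist H H' x : adj Q H = H -> adj Q H' = H' ->
  opn H <= 1 -> opn H' <= 1 ->
  `|Q (deform H x) (deform H x) - Q (deform H' x) (deform H' x)| <=
    expR 1 * opn (H - H') * Q x x.
Proof.
move=> Hs Hs' h1 h1'; rewrite !deform_dot // -linearBr /=.
rewrite (_ : _ - _ = (lfun_exp H - lfun_exp H') x); last first.
  by rewrite add_lfunE opp_lfunE.
rewrite (le_trans (dot_opnorm _ _ _ _)) // -expr2 dnrm_sqr.
by rewrite ler_wpM2r ?dot_ge0 // opnorm_expB.
Qed.

Lemma dot_opnorm_sqr H x : Q (H x) (H x) <= opn H ^+ 2 * Q x x.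
Proof.
rewrite -!dnrm_sqr -exprMn lerXn2r ?nnegrE ?mulr_ge0 ?dnrm_ge0 ?opnorm_ge0 //.
exact: opnormP.
Qed.

(** Non-minimal vectors have [Q x >= m + e], and a deformation shrinks [Q x] at most by the factor
    [1 - |H|]; the relative estimate is uniform over the infinite set. *)
Lemma deform_nonmin Z : admissible Z -> Z !=set0 ->
  exists2 e : R, 0 < e & exists2 eta : R, 0 < eta &
  forall H, adj Q H = H -> opn H < e -> forall x, Z x -> ~ minvec Q Z x ->
    hermite Q Z + eta <= Q (deform H x) (deform H x).
Proof.
move=> admZ Z0; have [e e0 he] := isolated_values Q (hermite Q Z) admZ.
set m := hermite Q Z in he *.
have m0 : 0 <= m by apply: hermite_ge => // x _; exact: dot_ge0.
(* Ensures [|H| (m + e) < e / 2], so that half of the gap survives. *)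
pose r := Num.min small_radius (e / 2 / (m + e)).
have me0 : 0 < m + e by rewrite ltr_wpDl.
exists r; first by rewrite lt_min small_radius_gt0 !divr_gt0.
exists (e / 2) => [|H Hs Hr x Zx xm]; first by rewrite divr_gt0.
move: Hr; rewrite lt_min => /andP[hr hm].
have qx : m + e <= Q x x.
  have := hermite_le Q Zx; rewrite -/m => mx; case: (he x Zx) => [xm'|].
    by case: xm.
  rewrite ger0_norm ?subr_ge0 //; lra.
have /andP[lo _] := deform_bounds x Hs (ltW hr); apply: le_trans lo.
have := dot_opnorm Q H x x; rewrite -expr2 dnrm_sqr ler_norml => /andP[lo _].
have q0 := dot_ge0 Q (H x).
have h0 := opnorm_ge0 Q H.
have h1 : opn H <= 1 by exact/small_radius_le1/ltW.
have hme : opn H * (m + e) < e / 2 by rewrite -ltr_pdivlMr.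
have : (1 - opn H) * (m + e) <= (1 - opn H) * Q x x.
  by rewrite ler_wpM2l // subr_ge0.
lra.
Qed.

Lemma hermite_image_le (g : 'End(V)) Z x : Z x -> hermite Q (g @` Z) <= Q (g x) (g x).
Proof. by move=> Zx; apply: hermite_le; exists x. Qed.

Lemma hermite_image_ge (g : 'End(V)) Z a : Z !=set0 ->
  (forall x, Z x -> a <= Q (g x) (g x)) -> a <= hermite Q (g @` Z).
Proof.
move=> [x Zx] h; apply: hermite_ge; first by exists (g x), x.
by move=> _ [y Zy <-]; exact: h.
Qed.

Lemma id_isometry G : closed_linear_group G -> isometries Q G \1%VF.
Proof.
move=> [GGL G1 _ _ _]; split=> //.
have -> : adj Q \1%VF = \1%VF by apply: adj_unique => x y; rewrite !id_lfunE.
apply/lfunP => x; rewrite -{2}[x](id_lfunE x) lker0_lfunK ?id_lfunE //.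
exact: GGL.
Qed.

Lemma Korbit_refl G Z : closed_linear_group G -> Korbit Q G Z Z.
Proof.
move=> cG; exists \1%VF; first exact: id_isometry.
by apply/seteqP; split=> [_ [x Zx <-]|x Zx]; [|exists x]; rewrite ?id_lfunE.
Qed.

Lemma extremeP G Z : closed_linear_group G -> extreme Q G Z <->
  exists2 e : R, 0 < e & forall H, lie_sym Q G H -> opn H < e ->
    hermite Q (deform H @` Z) <= hermite Q Z.
Proof.
move=> cG; split=> -[e e0 he]; exists e => //.
  move=> H pH He; apply: (he _ _ _ (Korbit_refl _ cG)).
  by exists H.
move=> _ [H [pH He] <-] _ [k kG <-].
by have [GGL _ _ _ _] := cG; rewrite (hermite_isometry _ GGL kG); exact: he.
Qed.

End Deformation.

(** * Extremality, perfection and eutaxy *)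

Section Criterion.
Context {R : realType} {V : vectType R} (Q : {dot V for idfun}).
Implicit Types (Z X : set V) (H D : 'End(V)) (G : set 'End(V)) (s : seq V).
Local Notation opn := (opnorm Q).

Lemma sum_seq_le (T : eqType) (s : seq T) (F : T -> R) (u : R) :
  (forall x, x \in s -> F x <= u) -> \sum_(x <- s) F x <= (size s)%:R * u.
Proof.
elim: s => [|y s IH] h; first by rewrite big_nil mul0r.
rewrite big_cons /= -nat1r mulrDl mul1r lerD ?h ?mem_head //.
by apply: IH => x xs; apply: h; rewrite in_cons xs orbT.
Qed.

Lemma seq_gap (T : eqType) (s : seq T) (F : T -> R) (m : R) :
  (forall x, x \in s -> m < F x) ->
  exists2 g : R, 0 < g & forall x, x \in s -> m + g <= F x.
Proof.
elim: s => [|y s IH] h; first by exists 1.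
have [x xs|g g0 hg] := IH; first by apply: h; rewrite in_cons xs orbT.
exists (Num.min g (F y - m)); first by rewrite lt_min g0 subr_gt0 h ?mem_head.
have my : Num.min g (F y - m) <= F y - m by rewrite ge_min lexx orbT.
have mg : Num.min g (F y - m) <= g by rewrite ge_min lexx.
move=> x; rewrite in_cons => /orP[/eqP ->|/hg]; lra.
Qed.

(** Weak perfection with [c = 0] prevents [Q(y, H y)] from vanishing on all of [X]; eutaxy turns a
    positive value into a negative one. *)
Lemma negative_direction G X H : weakly_perfect Q G X -> eutactic Q G X ->
  lie_sym Q G H -> (exists2 x, X x & H x != 0) ->
  exists2 y, X y & Q y (H y) < 0.
Proof.
move=> wp eu [GH Hs] [x Xx Hx].
have [all0|] := pselect (forall y, X y -> Q y (H y) = 0).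
  have /(_ x Xx) : forall y, X y -> H y + adj Q H y = (2 * 0) *: y.
    by apply: wp => // y /all0 ->; rewrite mul0r.
  rewrite Hs mulr0 scale0r -mulr2n -scaler_nat => /eqP.
  by rewrite scaler_eq0 pnatr_eq0 (negbTE Hx).
move=> /existsNP[y /not_implyP[Xy]] /eqP; rewrite neq_lt => /orP[ylt|ygt].
  by exists y.
by apply: eu => //; exists y.
Qed.

(** The right-hand sum is twice the sum of the negative parts of [Q(x, H x)]. It is sublinear and
    positive on a complement of the operators killing [s], hence coercive there. *)
Lemma eutactic_coercive G s : closed_linear_group G ->
  weakly_perfect Q G [set` s] -> eutactic Q G [set` s] ->
  exists2 d : R, 0 < d & forall H, lie_sym Q G H ->
    d * \sum_(x <- s) dnrm Q (H x) <= \sum_(x <- s) (`|Q x (H x)| - Q x (H x)).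
Proof.
move=> cG wp eu.
pose nu H := \sum_(x <- s) dnrm Q (H x).
pose h H := \sum_(x <- s) (`|Q x (H x)| - Q x (H x)).
have [P hP] := subspace_vspace (lie_sym0 Q cG)
  (fun A B => @lie_symD _ _ Q G A B cG) (fun a A => @lie_symZ _ _ Q G a A).
have [N hN] : exists N : {vspace 'End(V)}, forall H,
    H \in N <-> lie_sym Q G H /\ forall x, x \in s -> H x = 0.
  apply: (@subspace_vspace _ _ [set H | lie_sym Q G H /\ forall x, x \in s -> H x = 0]).
  - by split=> [|x _]; [exact: lie_sym0|rewrite zero_lfunE].
  - move=> A B [pA A0] [pB B0]; split; first exact: lie_symD.
    by move=> x xs; rewrite add_lfunE A0 // B0 // addr0.
  - move=> a A [pA A0]; split; first exact: lie_symZ.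
    by move=> x xs; rewrite scale_lfunE A0 // scaler0.
pose U := (P :\: N)%VS.
have UP H : H \in U -> lie_sym Q G H by move/(subvP (diffvSl _ _))/hP.
have hS : sublinear (fun w : subvs_of U => h (vsval w)).
  split=> [A B|a A a0]; rewrite /h.
    rewrite -big_split /=; apply: ler_sum => x _.
    rewrite add_lfunE linearDr /=; have := ler_normD (Q x (vsval A x)) (Q x (vsval B x)).
    lra.
  rewrite mulr_sumr; apply: eq_bigr => x _.
  by rewrite scale_lfunE dotZr normrM ger0_norm // mulrBr.
have nuS : sublinear (fun w : subvs_of U => nu (vsval w)).
  split=> [A B|a A a0]; rewrite /nu.
    rewrite -big_split /=; apply: ler_sum => x _.
    by rewrite add_lfunE dnrmD.
  rewrite mulr_sumr; apply: eq_bigr => x _.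
  by rewrite scale_lfunE dnrmZ ger0_norm.
have hpos (w : subvs_of U) : w != 0 -> 0 < h (vsval w).
  move=> w0; have pw := UP _ (subvsP w).
  have [x xs wx] : exists2 x, x \in s & vsval w x != 0.
    apply: contrapT => nex; move/negP: w0; apply.
    rewrite -(inj_eq val_inj) /= -memv0 -(capv_diff P N) memv_cap subvsP /=.
    apply/hN; split=> // x xs; apply/eqP/negPn/negP => wx; apply: nex.
    by exists x.
  have [y ys wy] := negative_direction wp eu pw (ex_intro2 _ _ x xs wx).
  rewrite /h lt_neqAle eq_sym psumr_neq0 => [|z _]; last by rewrite subr_ge0 ler_norm.
  apply/andP; split; last by apply: sumr_ge0 => z _; rewrite subr_ge0 ler_norm.
  apply/hasP; exists y => //=; rewrite ltr0_norm //; lra.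
have [d d0 hd] := sublinear_coercive hS hpos.
have [C C0 hC] := sublinear_bound nuS.
have C1 : 0 < C + 1 by rewrite ltr_wpDl.
exists (d / (C + 1)) => [|H pH]; first by rewrite divr_gt0.
(* The component of [H] in [N] kills [s] and changes neither side. *)
have : H \in (U + P :&: N)%VS by rewrite addv_diff_cap; apply/hP.
move=> /memv_addP[A AU [B /memv_capP[_ /hN[_ B0]] HE]].
have HA x : x \in s -> H x = A x by move=> xs; rewrite HE add_lfunE B0 // addr0.
have -> : \sum_(x <- s) dnrm Q (H x) = nu (vsval (Subvs AU)).
  by apply: eq_big_seq => x xs; rewrite HA.
have -> : \sum_(x <- s) (`|Q x (H x)| - Q x (H x)) = h (vsval (Subvs AU)).
  by apply: eq_big_seq => x xs; rewrite HA.
rewrite (le_trans _ (hd _)) // -mulrA ler_wpM2l ?(ltW d0) //.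
rewrite mulrC ler_pdivrMr // (le_trans (hC _)) // mulrC ler_wpM2l //.
  exact: normr_ge0.
by rewrite lerDl.
Qed.

(** Unless [H] kills [X], some [y] has [Q(y, H y) < - u / 2] and [Q(H y) <= u / 2], where [u] is
    proportional to the sum of the [|H x|]. *)
Lemma good_descent G Z X : closed_linear_group G -> admissible Z ->
  X !=set0 -> X `<=` minvec Q Z -> weakly_perfect Q G X -> eutactic Q G X ->
  exists2 e : R, 0 < e & forall H, lie_sym Q G H -> opn H < e ->
    (forall x, X x -> H x = 0) \/
    exists2 x, X x & Q (deform H x) (deform H x) < hermite Q Z.
Proof.
move=> cG admZ X0 Xm wp eu.
have [t tE] := finite_minvec Q admZ.
have /finite_seqP[s sE] : finite_set X.
  by apply: sub_finite_set Xm _; rewrite tE; exact: finite_seq.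
rewrite sE in wp eu.
have [d d0 hd] := eutactic_coercive cG wp eu.
set m := hermite Q Z.
pose k : R := (size s)%:R.
have k0 : 0 < k.
  have [x] := X0; rewrite sE ltr0n => /=; by case: (s).
(* Ensures [|H| (sqrt m + 1) <= d / (4 k)], which will give [Q(H y) <= u / 2]; the [+ 1] keeps the
   denominator positive. *)
pose r := Num.min small_radius (d / (4 * k) / (Num.sqrt m + 1)).
have m1 : 0 < Num.sqrt m + 1 by rewrite ltr_wpDl ?sqrtr_ge0.
exists r; first by rewrite lt_min small_radius_gt0 !divr_gt0 // mulr_gt0.
move=> H pH; rewrite lt_min => /andP[hr hm].
have [all0|/existsNP[x /not_implyP[Xx Hx]]] :=
  pselect (forall x, X x -> H x = 0); [by left|right].
pose nu := \sum_(x <- s) dnrm Q (H x).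
have nu_ge y : y \in s -> dnrm Q (H y) <= nu.
  move=> ys; rewrite /nu (perm_big _ (perm_to_rem ys)) /= big_cons lerDl.
  by apply: sumr_ge0 => z _; exact: dnrm_ge0.
have nu0 : 0 < nu.
  have xs : x \in s by move: Xx; rewrite sE.
  by apply: lt_le_trans (nu_ge x xs); apply: dnrm_gt0; apply/eqP.
(* Half of the lower bound [d * nu / k] for the average over [s], so some term exceeds it. *)
pose u := d * nu / (2 * k).
have [y ys hy] : exists2 y, y \in s & u < `|Q y (H y)| - Q y (H y).
  apply: contrapT => nex.
  have : d * nu <= k * u.
    apply: le_trans (hd H pH) _; apply: sum_seq_le => z zs.
    by rewrite leNgt; apply/negP => hz; apply: nex; exists z.
  rewrite (_ : k * u = d * nu / 2); last by rewrite /u; field; rewrite gt_eqF.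
  have := mulr_gt0 d0 nu0; lra.
have Xy : X y by rewrite sE.
exists y => //; have [_ [GH Hs]] := (Xm y Xy, pH).
have [_ ym] := Xm y Xy.
have /andP[_ up] := deform_bounds y Hs (ltW hr); apply: (le_lt_trans up).
have u0 : 0 < u by rewrite divr_gt0 ?mulr_gt0.
have yneg : Q y (H y) < - (u / 2).
  have [q0|q0] := leP 0 (Q y (H y)); first by move: hy; rewrite ger0_norm //; lra.
  by move: hy; rewrite ltr0_norm //; lra.
have ym' : dnrm Q y = Num.sqrt m by rewrite /dnrm ym.
have : Q (H y) (H y) <= u / 2.
  rewrite -dnrm_sqr expr2.
  apply: (@le_trans _ _ (nu * (opn H * (Num.sqrt m + 1)))).
    rewrite ler_pM ?dnrm_ge0 ?nu_ge // (le_trans (opnormP _ _ _)) // ym'.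
    by rewrite ler_wpM2l ?opnorm_ge0 // lerDl.
  rewrite (_ : u / 2 = nu * (d / (4 * k))); last by rewrite /u; field; rewrite gt_eqF.
  by rewrite ler_wpM2l ?(ltW nu0) // -ler_pdivlMr // ltW.
rewrite -/m in ym; lra.
Qed.

Lemma sym_part_neq0 H x : Q x (H x) != 0 -> sym_part Q H x != 0.
Proof.
by apply: contra_neq => Dx; rewrite -(sym_part_dot Q H) Dx linear0r.
Qed.

(** If eutaxy fails, the symmetric part of a counterexample works. If weak perfection fails with
    constant [c], multiplying the symmetric part by [c] gives the values [c^2 Q(x)], whatever the
    sign of [c]; for [c = 0] the symmetric part itself works. *)
Lemma ascent_direction G X : closed_linear_group G ->
  (forall g, G g -> G (adj Q g)) -> X !=set0 -> ~ X 0 ->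
  ~ (weakly_perfect Q G X /\ eutactic Q G X) ->
  exists2 D, lie_sym Q G D &
    (forall x, X x -> 0 <= Q x (D x)) /\ exists2 x, X x & D x != 0.
Proof.
move=> cG Gadj [x0 Xx0] X0 /not_andP[|].
  move=> /existsNP[H /existsNP[c /not_implyP[GH /not_implyP[hc]]]].
  move=> /existsNP[x /not_implyP[Xx /eqP hx]].
  have pD := sym_part_lie cG Gadj GH; set D := sym_part Q H in pD *.
  have DE y : X y -> Q y (D y) = c * Q y y by rewrite sym_part_dot; exact: hc.
  have [c0|c0] := eqVneq c 0.
    exists D => //; split=> [y Xy|]; first by rewrite DE // c0 mul0r.
    exists x => //; apply: contra_neq hx => Dx.
    rewrite c0 mulr0 scale0r -[LHS]scale1r -(@mulfV _ 2%:R) ?pnatr_eq0 //.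
    by rewrite -scalerA -[H x + _]add_lfunE -[2^-1 *: _]scale_lfunE -/(sym_part Q H) -/D Dx scaler0.
  exists (c *: D); first exact: lie_symZ.
  have cDE y : X y -> Q y ((c *: D) y) = c ^+ 2 * Q y y.
    by move=> Xy; rewrite scale_lfunE dotZr DE // mulrA.
  split=> [y Xy|]; first by rewrite cDE // mulr_ge0 ?sqr_ge0 ?dot_ge0.
  exists x0 => //; apply/eqP => Dx; have := cDE x0 Xx0.
  rewrite Dx linear0r => /esym/eqP; rewrite mulf_eq0 sqrf_eq0 (negbTE c0) /=.
  by move/eqP/(dot_eq0 (Q := Q)) => x00; apply: X0; rewrite -x00.
move=> /existsNP[H /not_implyP[GH /not_implyP[[x Xx Hx] nneg]]].
exists (sym_part Q H); first exact: sym_part_lie.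
split=> [y Xy|]; last by exists x => //; apply: sym_part_neq0; rewrite gt_eqF.
rewrite sym_part_dot leNgt; apply/negP => Hy; apply: nneg; by exists y.
Qed.

Lemma small_multiple D (d : R) : 0 < d -> exists2 t, 0 < t & t * opn D < d.
Proof.
move=> d0; have D1 : 0 < opn D + 1 by rewrite ltr_wpDl ?opnorm_ge0.
exists (d / (opn D + 1)); first by rewrite divr_gt0.
by rewrite mulrAC ltr_pdivrMr // ltr_pM2l // ltrDl.
Qed.

(** The invariant of the descent through subsets of [Z_min]: the list of all minimal vectors
    satisfies it through [H = 0], and at an extreme [Z] the empty list does not. *)
Definition flexible G Z s := forall e : R, 0 < e ->
  exists2 H, lie_sym Q G H & [/\ opn H < e,
    forall x, minvec Q Z x -> x \notin s ->
      hermite Q Z < Q (deform H x) (deform H x)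
  & forall x, x \in s -> H x = 0].

(** On [s] the operator [H + u D] acts as [u D], so a vector not killed by [D] gains at least
    [u^2 Q(D x) / 4]. Minimal vectors outside [s] stay raised because [u] is chosen after [H]. *)
Lemma flexible_step G Z s D : closed_linear_group G -> admissible Z ->
  (forall x, x \in s -> minvec Q Z x) -> lie_sym Q G D ->
  (forall x, x \in s -> 0 <= Q x (D x)) ->
  flexible G Z s -> flexible G Z [seq x <- s | D x == 0].
Proof.
move=> cG admZ sm pD D0 fl e e0; set m := hermite Q Z.
have [t tE] := finite_minvec Q admZ.
pose e' := Num.min (e / 2) (small_radius / 2).
have e'0 : 0 < e' by rewrite lt_min !divr_gt0 // small_radius_gt0.
have [ee re] : e' <= e / 2 /\ e' <= small_radius / 2.
  by rewrite !ge_min !lexx orbT.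
have [H pH [He Hs H0]] := fl e' e'0.
have [g g0 hg] : exists2 g : R, 0 < g & forall x, x \in [seq x <- t | x \notin s] ->
    m + g <= Q (deform H x) (deform H x).
  apply: seq_gap => x; rewrite mem_filter => /andP[xs xt].
  by apply: Hs => //; rewrite tE.
have cm0 : 0 < expR 1 * `|m| + 1 by rewrite ltr_wpDl // mulr_ge0 ?expR_ge0.
(* The second bound keeps the change of [Q] on the raised vectors, at most [expR 1 * (u |D|) * m],
   below their gap [g]. *)
have [u u0 uD] : exists2 u, 0 < u & u * opn D < Num.min e' (g / (expR 1 * `|m| + 1)).
  by apply: small_multiple; rewrite lt_min e'0 divr_gt0.
move: uD; rewrite lt_min ltr_pdivlMr // => /andP[uDe uDg].
have nuD : opn (u *: D) = u * opn D by rewrite opnormZ gtr0_norm.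
have pK : lie_sym Q G (H + u *: D) by apply: lie_symD => //; exact: lie_symZ.
have nK : opn (H + u *: D) < 2 * e'.
  by have := opnormD Q H (u *: D); rewrite nuD; lra.
have nKr : opn (H + u *: D) <= small_radius by lra.
exists (H + u *: D) => //; split; first by lra.
- move=> x xm; have [Zx xE] := xm; rewrite mem_filter negb_and.
  have [xs|xs _] := boolP (x \in s).
    rewrite orbF => Dx.
    have KE : (H + u *: D) x = u *: D x by rewrite add_lfunE scale_lfunE H0 // add0r.
    have /andP[lo _] := deform_bounds x pK.2 nKr.
    apply: lt_le_trans lo; rewrite KE xE !(dotZl, dotZr) -/m.
    have q0 : 0 < Q (D x) (D x) by exact: neq0_dnorm_gt0.
    have := mulr_gt0 u0 (mulr_gt0 u0 q0).
    by have := mulr_ge0 (ltW u0) (D0 x xs); lra.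
  have xt : x \in [seq x <- t | x \notin s].
    by rewrite mem_filter xs /=; have : [set` t] x by rewrite -tE.
  have := hg x xt; rewrite -/m.
  have H1 : opn H <= 1 by apply: small_radius_le1; lra.
  have := deform_dist x pH.2 pK.2 H1 (small_radius_le1 nKr).
  rewrite xE -/m opprD addrA subrr sub0r opnormN nuD ler_norml => /andP[_ h].
  have mm : m <= `|m| by exact: ler_norm.
  have k0 : 0 <= expR 1 * (u * opn D) by rewrite mulr_ge0 ?expR_ge0 // -nuD opnorm_ge0.
  have := ler_wpM2l k0 mm.
  have d0 : 0 <= u * opn D by rewrite -nuD opnorm_ge0.
  lra.
- move=> x; rewrite mem_filter => /andP[/eqP Dx xs].
  by rewrite add_lfunE scale_lfunE H0 // Dx scaler0 addr0.
Qed.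

(** The finitely many minimal vectors rise by a common [g] and all others stay [eta] above the
    minimum, so the Hermite function would increase strictly. *)
Lemma extreme_not_flexible0 G Z : closed_linear_group G -> admissible Z ->
  Z !=set0 -> extreme Q G Z -> ~ flexible G Z [::].
Proof.
move=> cG admZ Z0 /(extremeP _ _ cG)[e e0 he] fl.
have [t tE] := finite_minvec Q admZ.
have [e1 e10 [eta eta0 hnm]] := deform_nonmin Q admZ Z0.
have [|H pH [Hmin Hgt _]] := fl (Num.min e e1); first by rewrite lt_min e0 e10.
move: Hmin; rewrite lt_min => /andP[He He1].
have [g g0 hg] : exists2 g : R, 0 < g & forall x, x \in t ->
    hermite Q Z + g <= Q (deform H x) (deform H x).
  by apply: seq_gap => x xt; apply: Hgt; rewrite ?tE.
have := he H pH He; apply/negP; rewrite -ltNge.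
have mn0 : 0 < Num.min g eta by rewrite lt_min g0 eta0.
apply: (@lt_le_trans _ _ (hermite Q Z + Num.min g eta)); first by rewrite ltrDl.
apply: hermite_image_ge => // x Zx.
have [xm|xm] := pselect (minvec Q Z x).
  have xt : x \in t by have := xm; rewrite tE.
  by rewrite (le_trans _ (hg x xt)) // lerD2l ge_min lexx.
by rewrite (le_trans _ (hnm H pH.2 He1 x Zx xm)) // lerD2l ge_min lexx orbT.
Qed.

Lemma extreme_eutactic G Z : closed_linear_group G ->
  (forall g, G g -> G (adj Q g)) -> admissible Z -> Z !=set0 ->
  extreme Q G Z -> exists X : set V, [/\ X !=set0, X `<=` minvec Q Z,
    weakly_perfect Q G X & eutactic Q G X].
Proof.
move=> cG Gadj admZ Z0 ext; have [t tE] := finite_minvec Q admZ.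
have min0 x : minvec Q Z x -> x != 0.
  by move=> [Zx _]; apply: contraPneq Zx => ->; case: admZ.
have : flexible G Z t.
  move=> e e0; exists 0; first exact: lie_sym0.
  split; rewrite ?opnorm0 // => x; last by rewrite zero_lfunE.
  by rewrite tE => /= ->.
have : forall x, x \in t -> minvec Q Z x by move=> x; rewrite tE.
move: {tE} t => t; have [n] := ubnP (size t).
elim: n t => // n IH t; rewrite ltnS => tn tm fl.
have [good|bad] := pselect (weakly_perfect Q G [set` t] /\ eutactic Q G [set` t]).
  exists [set` t]; case: good => wp eu; split=> //.
  case: t {tn wp eu} tm fl => [_ /(extreme_not_flexible0 cG admZ Z0 ext)//|x t _ _].
  by exists x; rewrite /= mem_head.
have t0 : [set` t] !=set0.
  case: t {tn bad} tm fl => [_ /(extreme_not_flexible0 cG admZ Z0 ext)//|x t _ _].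
  by exists x; rewrite /= mem_head.
have tn0 : ~ [set` t] 0 by move=> /= /tm/min0; rewrite eqxx.
have [D pD [D0 [x xt Dx]]] := ascent_direction cG Gadj t0 tn0 bad.
(* The list is strictly shorter, since some [x] in [t] has [D x != 0]. *)
apply: (IH [seq y <- t | D y == 0]).
- apply: leq_trans tn; rewrite size_filter -(count_predC (fun y => D y == 0) t).
  rewrite -[X in (X < _)%N]addn0 ltn_add2l -has_count; apply/hasP.
  by exists x.
- by move=> y; rewrite mem_filter => /andP[_ /tm].
- exact: flexible_step.
Qed.

(** If [H] kills [X], the vector [x0] keeps its value and caps the Hermite function; otherwise some
    vector of [X] drops below the old minimum. *)
Lemma eutactic_extreme G Z X : closed_linear_group G -> admissible Z ->
  X !=set0 -> X `<=` minvec Q Z -> weakly_perfect Q G X -> eutactic Q G X ->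
  extreme Q G Z.
Proof.
move=> cG admZ [x0 Xx0] Xm wp eu; apply/extremeP => //.
have [e e0 he] := good_descent cG admZ (ex_intro _ x0 Xx0) Xm wp eu.
exists (Num.min e small_radius); first by rewrite lt_min e0 small_radius_gt0.
move=> H pH; rewrite lt_min => /andP[He Hr].
have [all0|[x Xx xlt]] := he H pH He; last first.
  have [Zx _] := Xm x Xx.
  by rewrite (le_trans (hermite_image_le _ _ Zx)) // ltW.
have [Zx xm] := Xm x0 Xx0; rewrite (le_trans (hermite_image_le _ _ Zx)) //.
have /andP[_ up] := deform_bounds x0 pH.2 (ltW Hr).
by move: up; rewrite all0 // !linear0r !addr0 xm.
Qed.

Lemma perfect_weakly_perfect G X : perfect Q G X -> weakly_perfect Q G X.
Proof.
move=> pf H c GH hc x Xx; have /lfunP/(_ x) := pf H c GH hc.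
by rewrite add_lfunE scale_lfunE id_lfunE.
Qed.

(** Perfection with [c = 0] forces an [H] killing [Z_min] to vanish; its class is then [K Z], which
    strictness leaves out. *)
Lemma perfect_strictly_extreme G Z : closed_linear_group G -> admissible Z ->
  Z !=set0 -> perfect Q G (minvec Q Z) -> eutactic Q G (minvec Q Z) ->
  strictly_extreme Q G Z.
Proof.
move=> cG admZ Z0 pf eu.
have [e e0 he] := good_descent cG admZ (minvec_nonempty Q admZ Z0)
  (fun x => id) (perfect_weakly_perfect pf) eu.
exists e => // _ [H [pH He] <-] nK _ [k kG <-].
have [GGL _ _ _ _] := cG; rewrite (hermite_isometry _ GGL kG).
have [all0|[x [Zx _] xlt]] := he H pH He; last first.
  exact: le_lt_trans (hermite_image_le _ _ Zx) xlt.
have H0 : H = 0.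
  have := pf H 0 pH.1; rewrite pH.2 mulr0 scale0r => h.
  have /eqP : H + H = 0 by apply: h => x xm; rewrite all0 // linear0r mul0r.
  by rewrite -mulr2n -scaler_nat scaler_eq0 pnatr_eq0 => /eqP.
case: nK; rewrite H0 scaler0 (lfun_exp0 Q); congr Korbit.
by apply/seteqP; split=> [_ [x Zx <-]|x Zx]; [|exists x]; rewrite ?id_lfunE.
Qed.

End Criterion.

(** * Rigidity at strict local maxima *)

Section Rigidity.
Context {R : realType} {V : vectType R} (Q : {dot V for idfun}).
Implicit Types (Z X : set V) (H D : 'End(V)) (G : set 'End(V)) (s : seq V).
Local Notation opn := (opnorm Q).

(** Along [D] no vector of [Z] falls below the minimum, so strict extremality leaves only the class
    of [Z]. *)
Lemma strictly_extreme_orbit G Z D : closed_linear_group G -> admissible Z ->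
  Z !=set0 -> strictly_extreme Q G Z -> lie_sym Q G D ->
  (forall x, minvec Q Z x -> 0 <= Q x (D x)) ->
  exists2 e : R, 0 < e & forall t : R, 0 < t -> t * opn D < e ->
    Korbit Q G Z (deform (t *: D) @` Z).
Proof.
move=> cG admZ Z0 [e e0 he] pD D0.
have [e1 e10 [eta eta0 hnm]] := deform_nonmin Q admZ Z0.
exists (Num.min small_radius (Num.min e e1)).
  by rewrite !lt_min small_radius_gt0 e0 e10.
move=> t t0; rewrite !lt_min => /and3P[tr te te1].
have nt : opn (t *: D) = t * opn D by rewrite opnormZ gtr0_norm.
have pH := lie_symZ t pD.
apply: contrapT => nK.
have : hermite Q (deform (t *: D) @` Z) < hermite Q Z.
  apply: (he (Korbit Q G (deform (t *: D) @` Z))).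
  - by exists (t *: D) => //; split; rewrite ?nt.
  - by move=> e2; apply: nK; rewrite -e2; exact: Korbit_refl.
  - exact: Korbit_refl.
apply/negP; rewrite -leNgt; apply: hermite_image_ge => // x Zx.
have [xm|xm] := pselect (minvec Q Z x); last first.
  have nt1 : opn (t *: D) < e1 by rewrite nt.
  by apply: le_trans (hnm _ pH.2 nt1 x Zx xm); rewrite lerDl ltW.
have ntr : opn (t *: D) <= small_radius by rewrite nt ltW.
have /andP[lo _] := deform_bounds x pH.2 ntr; apply: le_trans lo.
rewrite scale_lfunE !(dotZl, dotZr) xm.2.
have := mulr_ge0 (ltW t0) (D0 x xm).
have := mulr_ge0 (ltW t0) (mulr_ge0 (ltW t0) (dot_ge0 Q (D x))); lra.
Qed.

Lemma Korbit_dot G Z (g : 'End(V)) x : closed_linear_group G ->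
  Korbit Q G Z (g @` Z) -> Z x -> exists2 z, Z z & Q (g x) (g x) = Q z z.
Proof.
move=> [GGL _ _ _ _] [k [Gk kV] kZ] Zx.
have : (g @` Z) (g x) by exists x.
rewrite -kZ => -[z Zz <-]; exists z => //.
by rewrite adjP kV lker0_lfunK //; exact: GGL.
Qed.

(* The values of Q on Z are isolated, so t |-> Q (exp (t D / 2) b) is constant
   near 0; its expansion to second order then forces D b = 0. *)
Lemma strictly_extreme_rigid G Z D : closed_linear_group G -> admissible Z ->
  Z !=set0 -> strictly_extreme Q G Z -> lie_sym Q G D ->
  (forall x, minvec Q Z x -> 0 <= Q x (D x)) -> D = 0.
Proof.
move=> cG admZ Z0 sx pD D0.
have [e e0 he] := strictly_extreme_orbit cG admZ Z0 sx pD D0.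
have [_ _ _ Zspan] := admZ.
suff DZ b : Z b -> D b = 0.
  apply/lfunP => v; have [s sZ vs] := Zspan v; rewrite zero_lfunE.
  have /subvP/(_ v vs) : (span s <= lker D)%VS.
    by apply/span_subvP => x /sZ/DZ Dx; rewrite memv_ker Dx.
  by rewrite memv_ker => /eqP.
move=> Zb; have [eta eta0 heta] := isolated_values Q (Q b b) admZ.
have qb := dot_ge0 Q b.
have qb1 : 0 < 2 * Q b b + 1 by lra.
(* The last bound makes [Q] at [b] move by less than [eta], hence not at all. *)
pose d := Num.min (Num.min e small_radius) (eta / (2 * Q b b + 1)).
have d0 : 0 < d by rewrite !lt_min e0 small_radius_gt0 divr_gt0.
have [t t0 td] := small_multiple Q D d0.
(* With the value at [b] unchanged, [deform_bounds] divided by [u] brackets [- Q(b, D b)]. *)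
have key u : 0 < u -> u * opn D < d ->
    4^-1 * (u * Q (D b) (D b)) <= - Q b (D b) <= u * Q (D b) (D b).
  move=> u0; rewrite !lt_min => /andP[/andP[ue ur] ueta].
  have nu : opn (u *: D) = u * opn D by rewrite opnormZ gtr0_norm.
  have pH := lie_symZ u pD.
  have hr : opn (u *: D) <= small_radius by rewrite nu ltW.
  have := deform_bounds b pH.2 hr.
  have h1 := small_radius_le1 hr.
  have h0 := opnorm_ge0 Q (u *: D).
  have [z Zz zE] := Korbit_dot cG (he u u0 ue) Zb.
  have c1 := dot_opnorm Q (u *: D) b b; rewrite -expr2 dnrm_sqr in c1.
  have c2 := dot_opnorm_sqr Q (u *: D) b.
  have c3 : opn (u *: D) ^+ 2 * Q b b <= opn (u *: D) * Q b b.
    by rewrite ler_wpM2r // expr2 ler_piMl.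
  have c4 : opn (u *: D) * (2 * Q b b + 1) < eta by rewrite nu -ltr_pdivlMr.
  have q0 := dot_ge0 Q ((u *: D) b).
  rewrite zE => /andP[lo up].
  have zb : Q z z = Q b b.
    case: (heta z Zz) => // far; exfalso; move: far; apply/negP; rewrite -ltNge.
    move: c1; rewrite ler_norml ltr_norml => /andP[c1 c1'].
    apply/andP; split; lra.
  move: lo up; rewrite zb scale_lfunE !(dotZl, dotZr) => lo up.
  by clear -lo up u0; apply/andP; split; rewrite -(ler_pM2l u0); lra.
have /andP[k1 _] := key t t0 td.
(* The lower bound [t/4 * Q(D b)] at [t] and the upper bound [t/8 * Q(D b)] at [t / 8] are
   compatible only if [Q(D b) = 0]. *)
have t8 : t / 8 * opn D < d by have := mulr_ge0 (ltW t0) (opnorm_ge0 Q D); lra.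
have t80 : 0 < t / 8 by rewrite divr_gt0.
have /andP[_ k2] := key _ t80 t8.
have q0 := dot_ge0 Q (D b).
apply: (dot_eq0 (Q := Q)); apply/eqP; rewrite eq_le q0 andbT.
by rewrite -(pmulr_rle0 _ t0); lra.
Qed.

Lemma sym_part_eq0 H : sym_part Q H = 0 -> H + adj Q H = 0.
Proof.
by move/eqP; rewrite scaler_eq0 invr_eq0 pnatr_eq0 => /eqP.
Qed.

(** According to the sign of [c], the symmetric part of [H] or its opposite is nonnegative on
    [Z_min], so rigidity makes it zero; then [c = 0] because minimal vectors are nonzero. *)
Lemma strictly_extreme_perfect G Z : closed_linear_group G ->
  (forall g, G g -> G (adj Q g)) -> admissible Z -> Z !=set0 ->
  strictly_extreme Q G Z -> perfect Q G (minvec Q Z).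
Proof.
move=> cG Gadj admZ Z0 sx H c GH hc.
have pD := sym_part_lie cG Gadj GH.
have DE x : minvec Q Z x -> Q x (sym_part Q H x) = c * Q x x.
  by move=> xm; rewrite sym_part_dot hc.
have D0 : sym_part Q H = 0.
  have [c0|c0] := leP 0 c.
    apply: strictly_extreme_rigid cG admZ Z0 sx pD _ => x xm.
    by rewrite DE // mulr_ge0 ?dot_ge0.
  apply/eqP; rewrite -oppr_eq0 -scaleN1r; apply/eqP.
  apply: strictly_extreme_rigid cG admZ Z0 sx (lie_symZ (-1) pD) _ => x xm.
  by rewrite scale_lfunE dotZr DE // mulN1r -mulNr mulr_ge0 ?dot_ge0 // oppr_ge0 ltW.
have c0 : c = 0.
  have [x xm] := minvec_nonempty Q admZ Z0; have [Zx _] := xm.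
  have := DE x xm; rewrite D0 zero_lfunE linear0r => /esym/eqP.
  rewrite mulf_eq0 => /orP[/eqP //|/eqP/(dot_eq0 (Q := Q)) x0].
  by case: admZ => _ _ + _; rewrite -x0.
by rewrite (sym_part_eq0 D0) c0 mulr0 scale0r.
Qed.

(** The symmetric part of a counterexample is nonnegative on [Z_min], hence zero by rigidity,
    against its positive value. *)
Lemma strictly_extreme_eutactic G Z : closed_linear_group G ->
  (forall g, G g -> G (adj Q g)) -> admissible Z -> Z !=set0 ->
  strictly_extreme Q G Z -> eutactic Q G (minvec Q Z).
Proof.
move=> cG Gadj admZ Z0 sx H GH [x xm xpos]; apply: contrapT => nneg.
suff D0 : sym_part Q H = 0.
  by move: xpos; rewrite -(sym_part_dot Q H) D0 zero_lfunE linear0r ltxx.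
apply: strictly_extreme_rigid cG admZ Z0 sx (sym_part_lie cG Gadj GH) _ => y ym.
by rewrite sym_part_dot leNgt; apply/negP => Hy; apply: nneg; exists y.
Qed.

End Rigidity.

Theorem mainTheorem19 (R : realType) (V : vectType R) (Q : {dot V for idfun})
    (ZZ : set (set V)) (G : set 'End(V)) (Z : set V)
    (hV : alternative_voronoi_space Q ZZ G) (hZ : ZZ Z) :
  (strictly_extreme Q G Z <->
     perfect Q G (minvec Q Z) /\ eutactic Q G (minvec Q Z)) /\
  (extreme Q G Z <->
     exists X : set V, [/\ X !=set0, X `<=` minvec Q Z,
       weakly_perfect Q G X & eutactic Q G X]).
Proof.
have [ZZadm _ cG ZZscale Gadj _ _ _] := hV.
have admZ := ZZadm Z hZ.
(* The empty set, admissible when V = 0, would be stable under all scalings. *)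
have Z0 : Z !=set0.
  apply/set0P/negP => /eqP Z0.
  have /eqP : (2 : R) = 1; last by rewrite -subr_eq0 addrK oner_eq0.
  by apply: (ZZscale Z) => //; rewrite Z0 image_set0 -Z0.
split; split.
- move=> sx; split.
    exact: strictly_extreme_perfect.
  exact: strictly_extreme_eutactic.
- by move=> [pf eu]; exact: perfect_strictly_extreme.
- exact: extreme_eutactic.
- by move=> [X [X0 Xm wp eu]]; exact: eutactic_extreme X0 Xm wp eu.
Qed.
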